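(* Let $U \subset \mathbb{R}^d$ be nonempty, bounded, connected and open. There is a constant $C$ depending only on $(d,U)$ such that the following holds. Let $(x_n)_{n\ge1}$ be a sequence of points of $U$ such that $\{x_n : n \ge 1\}$ is dense in $U$, set $\Omega_n = \{x_1,\dots,x_n\}$ and $\varepsilon_n = \delta_H(\Omega_n,U)$, let $Q \subset \mathbb{R}^d$ be bounded and, for each $n$, let $\phi_n : \Omega_n \to Q$ be isotonic. Then there is a sequence of similarities $S_n$ such that, for all $n$, $$\max_{x \in \Omega_n} \|\phi_n(x) - S_n(x)\| \le C \operatorname{diam}(Q)\, \varepsilon_n.$$ Moreover, if $U = U^h$ for some $h>0$, then one can take $C = C'/\operatorname{diam}(U)$, where $C'$ is a function of $(d,\ h/\operatorname{diam}(U),\ \rho(U)/\operatorname{diam}(U))$ only.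
   Context: $\|\cdot\|$ is the Euclidean norm, $B(x,r)$ the open ball, $\operatorname{diam}(V) = \sup_{x,y\in V}\|x-y\|$. For $\Lambda\subset V\subset\mathbb{R}^d$, $\delta_H(\Lambda,V) = \sup_{y \in V}\inf_{x \in \Lambda}\|y-x\|$. $\rho(V) = \sup\{r>0 : \exists v \in V,\ B(v,r/2)\subset V\}$ is the diameter of a largest ball inscribed in $V$. For $h>0$, $V^h = \{x \in V : \exists y \in V \text{ with } x \in B(y,h) \subset V\}$. A function $f : A \to \mathbb{R}^d$, $A\subset\mathbb{R}^d$, is isotonic if for all $x,y,x',y' \in A$: $\|x-y\| < \|x'-y'\|$ implies $\|f(x)-f(y)\| \le \|f(x')-f(y')\|$. A similarity is a map $x \mapsto \lambda R(x) + b$ with $\lambda \ge 0$, $R$ orthogonal, $b \in \mathbb{R}^d$ (degenerate case $\lambda=0$ allowed). *)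

(* Defs.v *)
From HB Require Import structures.
From mathcomp Require Import all_boot all_order all_algebra.
From mathcomp Require Import all_classical all_reals all_analysis.
Set Implicit Arguments.
Unset Strict Implicit.
Unset Printing Implicit Defensive.
Import Order.TTheory GRing.Theory Num.Theory.
Import numFieldNormedType.Exports.
Local Open Scope classical_set_scope.
Local Open Scope ring_scope.

(* R^d is 'rV[R]_d. The library norm on 'rV[R]_d is the sup norm, so the
   Euclidean norm is defined here; [open], [connected], [closure] and
   [bounded_set] do not depend on the choice of norm and are the library's. *)
Definition enorm (R : realType) (d : nat) (x : 'rV[R]_d) : R :=
  Num.sqrt (\sum_(i < d) x ord0 i ^+ 2).

Definition eball (R : realType) (d : nat) (x : 'rV[R]_d) (r : R) :
    set 'rV[R]_d :=
  [set y | enorm (y - x) < r].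

(* [sup] and [inf] are real-valued, with junk value 0 on empty or unbounded
   sets; [diam], [deltaH] and [inradius_diam] are meant for bounded sets. *)
Definition diam (R : realType) (d : nat) (V : set 'rV[R]_d) : R :=
  sup [set enorm (p.1 - p.2) | p in V `*` V].

Definition deltaH (R : realType) (d : nat) (L V : set 'rV[R]_d) : R :=
  sup [set inf [set enorm (y - x) | x in L] | y in V].

(* rho(V), the diameter (hence r / 2) of a largest ball inscribed in V. *)
Definition inradius_diam (R : realType) (d : nat) (V : set 'rV[R]_d) : R :=
  sup [set r : R | 0 < r /\ exists2 v, V v & eball v (r / 2) `<=` V].

(* V^h *)
Definition hcore (R : realType) (d : nat) (V : set 'rV[R]_d) (h : R) :
    set 'rV[R]_d :=
  [set x | V x /\ exists y, [/\ V y, eball y h x & eball y h `<=` V]].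

(* A function A -> R^d is represented by a total function of which only the
   values on A matter. *)
Definition isotonic (R : realType) (d : nat) (A : set 'rV[R]_d)
    (f : 'rV[R]_d -> 'rV[R]_d) : Prop :=
  forall x y x' y', A x -> A y -> A x' -> A y' ->
    enorm (x - y) < enorm (x' - y') -> enorm (f x - f y) <= enorm (f x' - f y').

(* Vectors are rows, so the orthogonal matrix P acts on the right. *)
Definition similarity (R : realType) (d : nat) (S : 'rV[R]_d -> 'rV[R]_d) :
    Prop :=
  exists (l : R) (P : 'M[R]_d) (b : 'rV[R]_d),
    [/\ 0 <= l, P *m P^T = 1%:M & forall x, S x = l *: (x *m P) + b].

(* {x_1, ..., x_n}; sequences are indexed from 1, and x 0 is never used. *)
Definition Omega (R : realType) (d : nat) (x : nat -> 'rV[R]_d) (n : nat) :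
    set 'rV[R]_d :=
  [set x k | k in [set k | (1 <= k <= n)%N]].

(* C is an admissible constant for U. The norms being nonnegative, the default
   value 0 does not affect the maximum over x_1, ..., x_n. *)
Definition similarity_rate (R : realType) (d : nat) (U : set 'rV[R]_d) (C : R) :
    Prop :=
  forall (x : nat -> 'rV[R]_d) (Q : set 'rV[R]_d)
         (phi : nat -> 'rV[R]_d -> 'rV[R]_d),
    (forall n, (1 <= n)%N -> U (x n)) ->
    U `<=` closure [set x n | n in [set n | (1 <= n)%N]] ->
    bounded_set Q ->
    (forall n, (1 <= n)%N ->
      set_fun (Omega x n) Q (phi n) /\ isotonic (Omega x n) (phi n)) ->
    exists S : nat -> 'rV[R]_d -> 'rV[R]_d,
      forall n, (1 <= n)%N ->
        similarity (S n) /\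
        \big[Num.max/0]_(1 <= k < n.+1) enorm (phi n (x k) - S n (x k))
          <= C * diam Q * deltaH (Omega x n) U.

(* Main.v *)
(* Replacing each point of U by a nearest sample point turns phi_n into a
   map psi on U that respects the order of distances up to 4 * eps; write
   eta := diam Q * eps / r, where U contains a ball of radius r.
   (1) A pigeonhole argument on the images of a grid in that ball gives
   |psi x - psi y| <= K * (diam Q / r) * (|x - y| + eps), so that pairs at equal
   distance are mapped to pairs at equal distance up to O(eta).
   (2) Apply this to m and m +- t e_i: in dimension d, near equality of the
   distances forces psi m to be the midpoint of psi (m + t e_i) and
   psi (m - t e_i) up to O(eta).  Stability of the midpoint equation on a segment
   then gives |psi x - psi y| = lam * |x - y| + O(eta) for |x - y| <= r / 4.
   (3) Stability of Gram-Schmidt yields a similarity S close to psi on one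
   orthogonal frame, and trilateration propagates |psi - S| = O(eta) from a frame
   to all points at distance less than r / 8, hence along chains of frames.  The
   connectedness of U and a finite net bound the length of the chains.
   If eps > r / 20, a constant S will do. *)
Require Import Defs.
From HB Require Import structures.
From mathcomp Require Import all_boot all_order all_algebra.
From mathcomp Require Import all_classical all_reals all_analysis.
From mathcomp Require Import ring lra.
Set Implicit Arguments.
Unset Strict Implicit.
Unset Printing Implicit Defensive.
Import Order.TTheory GRing.Theory Num.Theory.
Import numFieldNormedType.Exports.
Local Open Scope classical_set_scope.
Local Open Scope ring_scope.

(** * Euclidean norm *)

Section Euclidean.
Context {R : realType} {d : nat}.
Implicit Types (u v w : 'rV[R]_d) (a : R).

Definition dot u v : R := (u *m v^T) ord0 ord0.

Lemma dotE u v : dot u v = \sum_(i < d) u ord0 i * v ord0 i.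
Proof. by rewrite /dot mxE; apply: eq_bigr => i _; rewrite mxE. Qed.

Lemma dotC u v : dot u v = dot v u.
Proof. by rewrite !dotE; apply: eq_bigr => i _; rewrite mulrC. Qed.

Lemma dotDl u v w : dot (u + v) w = dot u w + dot v w.
Proof. by rewrite /dot mulmxDl mxE. Qed.

Lemma dotZl a u v : dot (a *: u) v = a * dot u v.
Proof. by rewrite /dot -scalemxAl mxE. Qed.

Lemma dotNl u v : dot (- u) v = - dot u v.
Proof. by rewrite -scaleN1r dotZl mulN1r. Qed.

Lemma dotDr u v w : dot u (v + w) = dot u v + dot u w.
Proof. by rewrite dotC dotDl !(dotC u). Qed.

Lemma dotZr a u v : dot u (a *: v) = a * dot u v.
Proof. by rewrite dotC dotZl dotC. Qed.

Lemma dotNr u v : dot u (- v) = - dot u v.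
Proof. by rewrite dotC dotNl dotC. Qed.

Lemma dotBl u v w : dot (u - v) w = dot u w - dot v w.
Proof. by rewrite dotDl dotNl. Qed.

Lemma dotBr u v w : dot u (v - w) = dot u v - dot u w.
Proof. by rewrite dotDr dotNr. Qed.

Lemma dot_sumr (I : Type) (r : seq I) (P : pred I) (F : I -> 'rV[R]_d) u :
  dot u (\sum_(i <- r | P i) F i) = \sum_(i <- r | P i) dot u (F i).
Proof.
apply: (big_morph (dot u)); first by move=> v w; rewrite dotDr.
by rewrite -(scale0r u) dotZr mul0r.
Qed.

Lemma dot_ge0 u : 0 <= dot u u.
Proof. by rewrite dotE sumr_ge0// => i _; rewrite -expr2 sqr_ge0. Qed.

Lemma enormE u : enorm u = Num.sqrt (dot u u).
Proof. by rewrite /enorm dotE. Qed.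

Lemma enorm_ge0 u : 0 <= enorm u.
Proof. exact: sqrtr_ge0. Qed.

Lemma sqr_enorm u : enorm u ^+ 2 = dot u u.
Proof. by rewrite enormE sqr_sqrtr// dot_ge0. Qed.

Lemma enorm0 : enorm (0 : 'rV[R]_d) = 0.
Proof. by rewrite enormE -(scale0r 0) dotZl mul0r sqrtr0. Qed.

Lemma enormZ a u : enorm (a *: u) = `|a| * enorm u.
Proof.
by rewrite !enormE dotZl dotZr mulrA -expr2 sqrtrM ?sqr_ge0// sqrtr_sqr.
Qed.

Lemma enormN u : enorm (- u) = enorm u.
Proof. by rewrite -scaleN1r enormZ normrN1 mul1r. Qed.

Lemma enormC u v : enorm (u - v) = enorm (v - u).
Proof. by rewrite -enormN opprB. Qed.

Lemma coord_le_enorm u i : `|u ord0 i| <= enorm u.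
Proof.
rewrite -(ler_pXn2r (n := 2)) ?nnegrE ?enorm_ge0// sqr_enorm dotE real_normK ?num_real//.
rewrite (bigD1 i)//= -expr2 lerDl sumr_ge0// => j _.
by rewrite -expr2 sqr_ge0.
Qed.

Lemma enorm_eq0 u : enorm u = 0 -> u = 0.
Proof.
move=> u0; apply/rowP => i; rewrite mxE; apply/eqP; rewrite -normr_eq0.
by rewrite eq_le normr_ge0 andbT -u0 coord_le_enorm.
Qed.

Lemma dot_le_enorm u v : `|dot u v| <= enorm u * enorm v.
Proof.
have [v0|v0] := eqVneq (enorm v) 0.
  by rewrite (enorm_eq0 v0) -(scale0r 0) dotZr mul0r normr0 mulr_ge0// enorm_ge0.
have vv : 0 < dot v v.
  by rewrite -sqr_enorm exprn_gt0// lt_def v0 enorm_ge0.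
rewrite -(ler_pXn2r (n := 2)) ?nnegrE ?mulr_ge0 ?enorm_ge0//.
rewrite real_normK ?num_real// exprMn !sqr_enorm.
have := dot_ge0 (dot v v *: u - dot u v *: v).
rewrite !(dotBl, dotBr, dotZl, dotZr) (dotC v u).
rewrite (_ : _ - _ = dot v v * (dot u u * dot v v - dot u v ^+ 2)); last by ring.
by rewrite pmulr_rge0// subr_ge0.
Qed.

Lemma enormD u v : enorm (u + v) <= enorm u + enorm v.
Proof.
rewrite -(ler_pXn2r (n := 2)) ?nnegrE ?addr_ge0 ?enorm_ge0//.
rewrite sqrrD !sqr_enorm !(dotDl, dotDr) (dotC v u).
have := le_trans (ler_norm _) (dot_le_enorm u v).
by move: (enorm u * enorm v) => z; lra.
Qed.

Lemma enormB u v : enorm (u - v) <= enorm u + enorm v.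
Proof. by rewrite -(enormN v) enormD. Qed.

Lemma enorm_triangle v u w : enorm (u - w) <= enorm (u - v) + enorm (v - w).
Proof. by apply: le_trans (enormD _ _); rewrite addrA subrK. Qed.

Lemma enorm_dist u v : `|enorm u - enorm v| <= enorm (u - v).
Proof.
have := enormD (u - v) v; have := enormD (v - u) u.
by rewrite !subrK (enormC v u) ler_norml => *; apply/andP; split; lra.
Qed.

Lemma enorm_le_sum u : enorm u <= \sum_(i < d) `|u ord0 i|.
Proof.
rewrite -(ler_pXn2r (n := 2)) ?nnegrE ?enorm_ge0 ?sumr_ge0// sqr_enorm dotE.
rewrite expr2 mulr_suml; apply: ler_sum => i _.
rewrite -expr2 -real_normK ?num_real// expr2 ler_wpM2l//.
by rewrite (bigD1 i)//= lerDl sumr_ge0.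
Qed.

Lemma enorm_le_coord u a : (forall i, `|u ord0 i| <= a) -> enorm u <= d%:R * a.
Proof.
move=> ua; apply: le_trans (enorm_le_sum u) _.
apply: (@le_trans _ _ (\sum_(i < d) a)); first exact: ler_sum.
by rewrite sumr_const card_ord mulr_natl.
Qed.

Lemma enorm_sum (I : Type) (r : seq I) (P : pred I) (F : I -> 'rV[R]_d) :
  enorm (\sum_(i <- r | P i) F i) <= \sum_(i <- r | P i) enorm (F i).
Proof.
elim/big_ind2 : _ => [|u a v b ua vb|//]; first by rewrite enorm0.
by apply: le_trans (enormD _ _) (lerD ua vb).
Qed.

Definition evec (i : 'I_d) : 'rV[R]_d := delta_mx ord0 i.

Lemma dot_evec i j : dot (evec i) (evec j) = (i == j)%:R.
Proof. by rewrite /dot trmx_delta mul_delta_mx_cond mulmxnE mxE !eqxx. Qed.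

Lemma enorm_evec i : enorm (evec i) = 1.
Proof. by rewrite enormE dot_evec eqxx sqrtr1. Qed.

Lemma dot_orthogonal (P : 'M[R]_d) u v :
  P *m P^T = 1%:M -> dot (u *m P) (v *m P) = dot u v.
Proof. by move=> PP; rewrite /dot trmx_mul -mulmxA (mulmxA P) PP mul1mx. Qed.

Lemma enorm_orthogonal (P : 'M[R]_d) u :
  P *m P^T = 1%:M -> enorm (u *m P) = enorm u.
Proof. by move=> PP; rewrite !enormE dot_orthogonal. Qed.

Lemma enorm_le_orthonormal (P : 'M[R]_d) u a :
  P *m P^T = 1%:M -> (forall i, `|dot u (row i P)| <= a) -> enorm u <= d%:R * a.
Proof.
move=> PP ua; rewrite -(@enorm_orthogonal P^T) ?trmxK; last exact: mulmx1C.
apply: enorm_le_coord => i; apply: le_trans (ua i).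
rewrite dotE mxE le_eqVlt; apply/orP; left; apply/eqP; congr `| _ |.
by apply: eq_bigr => j _; rewrite !mxE.
Qed.

End Euclidean.

(** * Stability of orthonormal frames *)

Section GramSchmidt.
Context {R : realType}.

Lemma enorm_near1 d (a : 'rV[R]_d) (delta : R) :
  `|dot a a - 1| <= delta -> `|enorm a - 1| <= delta.
Proof.
apply: le_trans; rewrite -sqr_enorm subr_sqr_1 normrM ler_peMr//.
by rewrite ger0_norm ?addr_ge0 ?enorm_ge0// lerDr enorm_ge0.
Qed.

(** Induction on [k]: the new vector is projected off the frame already built and then normalised,
    and each round multiplies the error by a factor depending only on [k]. Indexing by naturals lets
    the induction extend the family. *)
Lemma gram_schmidt_stability (d k : nat) :
  exists2 K : R, 1 <= K &
  forall (a : nat -> 'rV[R]_d) (delta : R), 0 <= delta -> K * delta <= 1 ->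
  (forall i j, (i < k)%N -> (j < k)%N ->
     `|dot (a i) (a j) - (i == j)%:R| <= delta) ->
  exists u : nat -> 'rV[R]_d,
    (forall i j, (i < k)%N -> (j < k)%N -> dot (u i) (u j) = (i == j)%:R) /\
    (forall i, (i < k)%N -> enorm (a i - u i) <= K * delta).
Proof.
elim: k => [|k [K K1 IH]]; first by exists 1 => // a; exists (fun=> 0).
(* The projection [v] has norm at most [3 * k * K * delta] and [enorm (a k)] is [1] up to [delta];
   [c] adds both. The factor 2 below counts the removal of [v] and the normalisation. *)
set c : R := 3 * k%:R + 1.
have c1 : 1 <= c by rewrite /c lerDr mulr_ge0// ler0n.
have cK1 : 1 <= c * K by rewrite mulr_ege1.
have KcK : K <= c * K by rewrite ler_peMl//; lra.
exists (2 * (c * K)); first by lra.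
move=> a delta delta0 small gram.
have cKd : 0 <= c * K * delta by rewrite mulr_ge0//; lra.
have dcK : delta <= c * K * delta by rewrite ler_peMl.
have KdcK : K * delta <= c * K * delta by rewrite ler_wpM2r.
have [|i j ik jk|u [orth close]] := IH a delta delta0.
- by lra.
- by apply: gram; rewrite ltnS ltnW.
have ak1 : `|enorm (a k) - 1| <= delta.
  by apply: enorm_near1; have := gram k k (ltnSn k) (ltnSn k); rewrite eqxx.
have ak2 : enorm (a k) <= 2 by move: ak1; rewrite ler_norml; lra.
pose v := \sum_(j < k) dot (a k) (u j) *: u j.
have coef (j : 'I_k) : `|dot (a k) (u j)| <= 3 * (K * delta).
  rewrite -[u j](subKr (a j)) dotBr.
  have h1 : `|dot (a k) (a j)| <= delta.
    have := gram k j (ltnSn k) (ltnW (ltn_ord j)).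
    by rewrite gtn_eqF ?subr0.
  have h2 : `|dot (a k) (a j - u j)| <= 2 * (K * delta).
    apply: le_trans (dot_le_enorm _ _) _.
    by apply: ler_pM; rewrite ?enorm_ge0// close.
  apply: le_trans (ler_normB _ _) _.
  have : delta <= K * delta by rewrite ler_peMl.
  by lra.
have vle : enorm v <= 3 * k%:R * K * delta.
  apply: le_trans (@enorm_sum _ _ _ _ _ _) _.
  apply: (@le_trans _ _ (\sum_(j < k) 3 * (K * delta))).
    apply: ler_sum => j _; rewrite enormZ -[leRHS]mulr1.
    rewrite ler_pM ?enorm_ge0// enormE orth// eqxx sqrtr1//.
  by rewrite sumr_const card_ord -[leLHS]mulr_natl; lra.
pose w := a k - v.
have wu (j : nat) : (j < k)%N -> dot w (u j) = 0.
  move=> jk; rewrite dotBl (dotC v) dot_sumr (bigD1 (Ordinal jk))//= dotZr.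
  rewrite orth// eqxx mulr1 big1 ?addr0 ?subrr// => i ij.
  rewrite dotZr orth// [_ == _](_ : _ = false) ?mulr0//.
  by apply: contra_neqF ij => /eqP ji; apply/val_inj.
have w1 : `|enorm w - 1| <= c * K * delta.
  have h : `|enorm w - enorm (a k)| <= enorm v.
    by apply: le_trans (enorm_dist _ _) _; rewrite /w addrAC subrr add0r enormN.
  apply: le_trans (ler_distD (enorm (a k)) _ _) _.
  apply: le_trans (lerD (le_trans h vle) ak1) _.
  have : delta <= K * delta by rewrite ler_peMl.
  by rewrite /c; lra.
have wpos : 0 < enorm w by move: w1; rewrite ler_norml; lra.
pose t := (enorm w)^-1 *: w.
have tw : enorm (w - t) <= c * K * delta.
  apply: le_trans w1.
  rewrite /t -[X in X - _](scale1r w) -scalerBl enormZ -[X in _ * X]ger0_norm ?enorm_ge0//.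
  by rewrite -normrM mulrBl mul1r mulVf// gt_eqF.
have tu (j : nat) : (j < k)%N -> dot t (u j) = 0.
  by move=> jk; rewrite dotZl wu// mulr0.
have tt : dot t t = 1.
  rewrite -sqr_enorm enormZ ger0_norm ?invr_ge0 ?enorm_ge0//.
  by rewrite mulVf ?expr1n// gt_eqF.
exists (fun i => if i == k then t else u i); split.
  move=> i j; rewrite (ltnS i) (ltnS j) (leq_eqVlt i) (leq_eqVlt j).
  have [->|ik] := eqVneq i k; have [->|jk] := eqVneq j k => /= lti ltj.
  - by [].
  - by rewrite tu// eq_sym (negbTE jk).
  - by rewrite dotC tu// (negbTE ik).
  - by rewrite orth.
move=> i; rewrite ltnS leq_eqVlt.
have [-> _|ik] := eqVneq i k => /=; last first.
  by move=> ik'; apply: le_trans (close i ik') _; lra.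
apply: le_trans (enorm_triangle w _ _) _.
rewrite (_ : a k - w = v); last by rewrite /w subKr.
have : 3 * k%:R * K * delta <= c * K * delta.
  rewrite ler_wpM2r// ler_wpM2r ?/c; lra.
by lra.
Qed.

(** No smallness of [delta] is asked for: if [K * delta > 1], each vector of the standard frame is
    already within [2 + delta] of its [a i]. *)
Lemma near_orthonormal (d : nat) :
  exists2 K : R, 1 <= K &
  forall (a : 'I_d -> 'rV[R]_d) (delta : R), 0 <= delta ->
  (forall i j, `|dot (a i) (a j) - (i == j)%:R| <= delta) ->
  exists2 P : 'M[R]_d, P *m P^T = 1%:M &
    forall i, enorm (a i - row i P) <= K * delta.
Proof.
have [K K1 gs] := gram_schmidt_stability d d.
exists (2 * K + 1) => [|a delta delta0 gram]; first by lra.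
have Kd0 : 0 <= K * delta by rewrite mulr_ge0//; lra.
case: (lerP (K * delta) 1) => [small|big]; last first.
  exists 1%:M; first by rewrite trmx1 mulmx1.
  move=> i; rewrite rowE mulmx1; apply: le_trans (enormB _ _) _.
  rewrite [enorm (delta_mx _ _)]enorm_evec.
  have : `|enorm (a i) - 1| <= delta.
    by apply: enorm_near1; have := gram i i; rewrite eqxx.
  by rewrite ler_norml; lra.
case: d a gram gs => [|d] a gram gs.
  by exists 1%:M => [|[]//]; rewrite trmx1 mulmx1.
have [|u [orth close]] := gs (fun i => a (inord i)) delta delta0 small.
  move=> i j id jd; apply: le_trans (gram (inord i) (inord j)).
  by rewrite -(inj_eq val_inj) /= !inordK.
exists (\matrix_i u i) => [|i]; last first.
  by rewrite rowK; have := close i (ltn_ord i); rewrite inord_val; lra.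
apply/matrixP => i j; rewrite mxE [RHS]mxE -(inj_eq val_inj).
rewrite -[RHS](orth i j (ltn_ord i) (ltn_ord j)) dotE.
by apply: eq_bigr => k _; rewrite !mxE.
Qed.

(** Once normalised, the [q i] are close to an orthonormal frame, in which each coordinate of [m] is
    at most [beta] plus a small multiple of [enorm m]. The condition [K * beta <= A] lets that
    multiple be absorbed on the left. *)
Lemma near_orthogonal_bound (d : nat) :
  exists2 K : R, 1 <= K &
  forall (q : 'I_d -> 'rV[R]_d) (m : 'rV[R]_d) (A beta : R),
  0 <= beta -> 0 < A -> K * beta <= A ->
  (forall i, A <= enorm (q i)) ->
  (forall i j, i != j -> `|dot (q i) (q j)| <= beta * A) ->
  (forall i, `|dot (q i) m| <= beta * A) ->
  enorm m <= K * beta.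
Proof.
have [K K1 no] := near_orthonormal d.
have d0 : 0 <= d%:R :> R by rewrite ler0n.
have dK0 : 0 <= d%:R * K by rewrite mulr_ge0//; lra.
exists (2 * (d%:R * K) + 1) => [|q m A beta beta0 A0 small qA qq qm]; first by lra.
have qpos i : 0 < enorm (q i) by apply: lt_le_trans (qA i).
pose a i := (enorm (q i))^-1 *: q i.
have scaled v i : `|dot (q i) v| <= beta * A -> `|dot (a i) v| <= beta.
  move=> qv; rewrite dotZl normrM ger0_norm ?invr_ge0 ?enorm_ge0//.
  rewrite ler_pdivrMl//; apply: le_trans qv _.
  by rewrite mulrC ler_wpM2r.
have [i j|P PP close] := no a (beta / A) (divr_ge0 beta0 (ltW A0)).
  case: (eqVneq i j) => [<-|ij] /=.
    rewrite dotZl dotZr -sqr_enorm mulrA -expr2 -exprMn mulVf ?gt_eqF//.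
    by rewrite expr1n subrr normr0 divr_ge0// ltW.
  rewrite subr0 dotZr normrM ger0_norm ?invr_ge0 ?enorm_ge0//.
  rewrite mulrC ler_pM ?invr_ge0 ?enorm_ge0//; first by apply: scaled; exact: qq.
  by rewrite lef_pV2 ?posrE.
have KbA : d%:R * (K * (beta / A)) <= 1 / 2.
  by rewrite !mulrA ler_pdivrMr//; lra.
have := @enorm_le_orthonormal _ _ P m (beta + K * (beta / A) * enorm m) PP.
move=> /(_ _)/wrap[i|].
  rewrite -[row i P](subKr (a i)) dotBr (dotC m (a i)) (dotC m).
  apply: le_trans (ler_normB _ _) _; apply: lerD; first exact: scaled.
  apply: le_trans (dot_le_enorm _ _) _.
  by rewrite ler_wpM2r ?enorm_ge0.
have m0 := enorm_ge0 m.
have := ler_wpM2r m0 KbA.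
have : d%:R * beta <= d%:R * K * beta by rewrite ler_wpM2r// ler_peMr.
by rewrite mulrDr mulrA; lra.
Qed.

Lemma sqr_dist_le (x y A eta : R) :
  0 <= x -> 0 <= y -> x <= A -> y <= A -> `|x - y| <= eta ->
  `|x ^+ 2 - y ^+ 2| <= eta * (2 * A).
Proof.
move=> x0 y0 xA yA xy; rewrite subr_sqr normrM ler_pM//.
by rewrite ger0_norm; lra.
Qed.

(* In dimension d the vectors [q i := p true i - p false i] span, and exact
   equality of the distances makes each [q i] orthogonal to every
   [p true j + p false j], which therefore vanishes. *)
Lemma cross_polytope_center (d : nat) :
  exists2 K : R, 1 <= K &
  forall (p : bool -> 'I_d -> 'rV[R]_d) (eta : R), 0 <= eta ->
  (forall b i c j, enorm (p b i) <= enorm (p c j) + eta) ->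
  (forall b c e f i j, i != j ->
     enorm (p b i - p c j) <= enorm (p e i - p f j) + eta) ->
  (forall b i j, enorm (p b i) <= enorm (p true j - p false j) + eta) ->
  forall j, enorm (p true j + p false j) <= K * eta.
Proof.
have [K K1 nob] := near_orthogonal_bound d.
exists (48 * K) => [|p eta eta0 radial lateral axial j]; first by lra.
pose A := enorm (p true j) + eta.
have pA b i : enorm (p b i) <= A by exact: radial.
have p0 b i : 0 <= enorm (p b i) by exact: enorm_ge0.
have mA : enorm (p true j + p false j) <= 2 * A.
  by apply: le_trans (enormD _ _) _; have := pA true j; have := pA false j; lra.
(* If [A] is small, the bound [2 * A] suffices. Otherwise [K * (12 * eta) <= A / 2], as [nob]
   requires for [q] with lower bound [A / 2]. *)
case: (lerP A (24 * (K * eta))) => [|big]; first by lra.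
have eK : eta <= K * eta by rewrite ler_peMl.
have A0 : 0 < A by lra.
pose q i := p true i - p false i.
(* The two endpoints of [q i] have nearly equal norms and nearly equal distances to [p c k];
   expanding the squares gives near orthogonality. *)
have qp (i : 'I_d) c (k : 'I_d) : i != k -> `|dot (q i) (p c k)| <= 6 * eta * (A / 2).
  move=> ik.
  pose x e := enorm (p e i); pose y e := enorm (p e i - p c k).
  have yA e : y e <= 2 * A.
    by apply: le_trans (enormB _ _) _; have := pA e i; have := pA c k; lra.
  have hx : `|x true ^+ 2 - x false ^+ 2| <= eta * (2 * A).
    apply: sqr_dist_le; rewrite /x//.
    by rewrite ler_distl; have := radial true i false i; have := radial false i true i; lra.
  have hy : `|y true ^+ 2 - y false ^+ 2| <= eta * (2 * (2 * A)).
    apply: sqr_dist_le; rewrite ?enorm_ge0//.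
    have := lateral true c false c i k ik; have := lateral false c true c i k ik.
    by rewrite ler_distl /y; lra.
  have -> : dot (q i) (p c k) =
      (x true ^+ 2 - x false ^+ 2 - (y true ^+ 2 - y false ^+ 2)) / 2.
    by rewrite /x /y !sqr_enorm !(dotBl, dotBr) !(dotC (p c k)); field.
  by move: hx hy; rewrite !ler_norml; lra.
have sum2 (u v w : 'rV[R]_d) (t : R) :
    `|dot u v| <= t -> `|dot u w| <= t ->
    `|dot u (v + w)| <= 2 * t /\ `|dot u (v - w)| <= 2 * t.
  by rewrite dotDr dotBr !ler_norml; lra.
have -> : 48 * K * eta = 4 * (K * (12 * eta)) by lra.
apply: (@le_trans _ _ (K * (12 * eta))); last by lra.
apply: (nob q _ (A / 2)) => [|||i|i k ik|i]; try lra.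
- by have := axial true i i; have := radial true j true i; rewrite /q /A in A0 big *; lra.
- have [_] := sum2 _ _ _ _ (qp i true k ik) (qp i false k ik).
  by lra.
(* For [i = j] the product is a difference of squared norms, controlled by [radial]. *)
- have [->|ij] := eqVneq i j; last first.
    have [+ _] := sum2 _ _ _ _ (qp i true j ij) (qp i false j ij).
    by lra.
  rewrite [dot _ _](_ : _ = enorm (p true j) ^+ 2 - enorm (p false j) ^+ 2).
    have := @sqr_dist_le _ _ A eta (p0 true j) (p0 false j) (pA _ _) (pA _ _).
    move=> /(_ _)/wrap[|]; last by have := mulr_ge0 eta0 (ltW A0); lra.
    by rewrite ler_distl; have := radial true j false j; have := radial false j true j; lra.
  by rewrite !sqr_enorm !(dotBl, dotDr) (dotC (p false j) (p true j)); ring.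
Qed.

End GramSchmidt.

(** * Coarsely isotonic maps *)

Section CoarselyIsotonic.
Context {R : realType} {d : nat}.
Implicit Types (U : set 'rV[R]_d) (psi : 'rV[R]_d -> 'rV[R]_d).

(** Meant for points of the cube [[0, k * mesh]^d]. There are [k + 1] values per axis because the
    upper face has index [k]. A finite function type turns pigeonhole into a comparison of
    cardinals. *)
Definition cell (k : nat) (mesh : R) (z : 'rV[R]_d) : {ffun 'I_d -> 'I_k.+1} :=
  [ffun i => inord (Num.truncn (z ord0 i / mesh))].

Lemma cell_close (k : nat) (mesh : R) (z z' : 'rV[R]_d) : 0 < mesh ->
  (forall i, 0 <= z ord0 i <= k%:R * mesh) ->
  (forall i, 0 <= z' ord0 i <= k%:R * mesh) ->
  cell k mesh z = cell k mesh z' ->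
  forall i, `|(z - z') ord0 i| <= mesh.
Proof.
move=> mesh0 zk zk' + i => /ffunP/(_ i); rewrite !ffunE => /(congr1 val) /=.
have bounds (t : R) : 0 <= t <= k%:R * mesh ->
    (Num.truncn (t / mesh) < k.+1)%N /\
    (Num.truncn (t / mesh))%:R * mesh <= t < (Num.truncn (t / mesh)).+1%:R * mesh.
  move=> /andP[t0 tk]; have /truncn_itv/andP[lo hi] : 0 <= t / mesh by rewrite divr_ge0// ltW.
  rewrite -ler_pdivlMr// -ltr_pdivrMr// lo hi; split=> //.
  by rewrite ltnS -(ler_nat R) (le_trans lo)// ler_pdivrMr.
have [b1 h1] := bounds _ (zk i); have [b2 h2] := bounds _ (zk' i).
rewrite !inordK// => e; move: h1 h2; rewrite e !mxE -natr1 ler_norml.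
by lra.
Qed.

(** Moving both endpoints of a pair by at most [e] changes its distance by at most [2 * e];
    comparing two pairs costs [4 * e]. *)
Definition coarsely_isotonic U (e : R) psi : Prop :=
  forall x y x' y', U x -> U y -> U x' -> U y' ->
    enorm (x - y) + 4 * e < enorm (x' - y') ->
    enorm (psi x - psi y) <= enorm (psi x' - psi y').

(* If [psi x] and [psi y] were far apart, so would be the images of all pairs
   of points of a grid of step slightly larger than [enorm (x - y)], and these
   images could not all fit in a set of diameter [D]. *)
Lemma coarsely_isotonic_lipschitz U psi (c : 'rV[R]_d) (r e D : R) :
  (0 < d)%N -> 0 < r -> 0 < e -> eball c r `<=` U ->
  coarsely_isotonic U e psi ->
  (forall x y, U x -> U y -> enorm (psi x - psi y) <= D) ->
  forall x y, U x -> U y ->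
    enorm (psi x - psi y) <= 60 * d%:R ^+ 2 * (D / r) * (enorm (x - y) + e).
Proof.
move=> d0 r0 e0 ball iso bounded x y Ux Uy.
have d1 : 1 <= d%:R :> R by rewrite ler1n.
have Uc : U c by apply: ball; rewrite /eball /= subrr enorm0.
have t0 := enorm_ge0 (x - y).
set t := enorm (x - y) in t0 *.
(* Any step above [t + 4 * e] forces the images of distinct grid points to be at least as far apart
   as [psi x] and [psi y]. *)
pose tau := t + 5 * e.
have tau0 : 0 < tau by rewrite /tau; lra.
have taue : tau <= 5 * (t + e) by rewrite /tau; lra.
have D0 : 0 <= D by apply: le_trans (enorm_ge0 _) (bounded x y Ux Uy).
have Dr0 : 0 <= D / r by rewrite divr_ge0// ltW.
(* Grid points with coordinates up to [X * tau] stay within [r / 2] of [c]. If [X < 2], then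
   [r < 4 * d * tau] and the bound [D] is enough. *)
pose X := r / (2 * d%:R * tau).
have den0 : 0 < 2 * d%:R * tau by rewrite mulr_gt0//; lra.
have rX : r = X * (2 * d%:R * tau) by rewrite divfK// gt_eqF.
have d2 : d%:R <= d%:R ^+ 2 :> R by rewrite expr2 ler_peMl//; lra.
have bound : 12 * d%:R ^+ 2 * (D / r) * tau <= 60 * d%:R ^+ 2 * (D / r) * (t + e).
  apply: le_trans (_ : 12 * d%:R ^+ 2 * (D / r) * (5 * (t + e)) <= _); last by lra.
  by apply: ler_wpM2l => //; apply: mulr_ge0 => //; apply: mulr_ge0 => //; apply: exprn_ge0; apply: ler0n.
apply: le_trans bound.
have Dfact : D = D / r * r by rewrite divfK// gt_eqF.
case: (ltrP X 2) => X2.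
  apply: le_trans (bounded x y Ux Uy) _.
  have rle : r <= 12 * d%:R ^+ 2 * tau.
    have : X * (2 * d%:R * tau) <= 2 * (2 * d%:R * tau).
      by rewrite ler_wpM2r//; exact: ltW.
    have := ler_wpM2r (ltW tau0) d2.
    have : 0 <= d%:R * tau by rewrite mulr_ge0// ltW.
    by rewrite -rX; lra.
  by have := ler_wpM2l Dr0 rle; rewrite -Dfact; lra.
have X0 : 0 <= X by lra.
have [k mk] : exists k, Num.truncn X = k.+2.
  have : (2 <= Num.truncn X)%N by rewrite truncn_ge_nat.
  by case: (Num.truncn X) => [|[|k]]// _; exists k.
have := truncn_itv X0; rewrite mk => /andP[Xlo Xhi].
pose grid (g : {ffun 'I_d -> 'I_k.+3}) : 'rV[R]_d := \row_i ((g i)%:R * tau).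
have gridU g : U (c + grid g).
  apply: ball; rewrite /eball /= addrAC subrr add0r.
  apply: (@le_lt_trans _ _ (d%:R * (k.+2%:R * tau))).
    apply: enorm_le_coord => i; rewrite mxE ger0_norm ?mulr_ge0 ?ler0n ?(ltW tau0)//.
    by rewrite ler_wpM2r ?(ltW tau0)// ler_nat -ltnS.
  have : d%:R * tau * k.+2%:R <= d%:R * tau * X.
    by rewrite ler_wpM2l// mulr_ge0//; lra.
  by have := rX; lra.
have sep g g' : g != g' -> enorm (psi x - psi y) <= enorm (psi (c + grid g) - psi (c + grid g')).
  move=> gg'; apply: iso => //; rewrite opprD addrACA subrr add0r.
  apply: (@lt_le_trans _ _ tau); first by rewrite /tau -/t; lra.
  have [i gi] : exists i, g i != g' i.
    apply/existsP; rewrite -negb_forall; apply: contra gg' => /forallP gg'.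
    by apply/eqP/ffunP => i; apply/eqP.
  apply: le_trans (coord_le_enorm _ i); rewrite !mxE -mulrBl normrM (gtr0_norm tau0).
  rewrite ler_peMl ?(ltW tau0)//.
  have := gi; rewrite -(inj_eq val_inj) neq_ltn => /orP[] lt.
    rewrite distrC ger0_norm ?subr_ge0 ?ler_nat 1?ltnW//.
    by rewrite lerBrDr nat1r ler_nat.
  rewrite ger0_norm ?subr_ge0 ?ler_nat 1?ltnW//.
  by rewrite lerBrDr nat1r ler_nat.
have [D00|Dneq0] := eqVneq D 0.
  by rewrite D00 mul0r mulr0 mul0r; have := bounded x y Ux Uy; rewrite D00.
have Dpos : 0 < D by rewrite lt_def Dneq0.
(* Translated by [D] along each axis, the images lie in [[0, 2 * D]^d], hence in
   [[0, (k + 1) * mesh]^d]. *)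
pose mesh := 2 * D / k.+1%:R.
have k0 : 0 < k.+1%:R :> R by rewrite ltr0n.
have mesh0 : 0 < mesh by rewrite divr_gt0//; lra.
pose img g : 'rV[R]_d := psi (c + grid g) - psi c + const_mx D.
have imgbnd g i : 0 <= img g ord0 i <= k.+1%:R * mesh.
  rewrite /mesh mulrC divfK ?gt_eqF// /img mxE [const_mx _ _ _]mxE.
  have := le_trans (coord_le_enorm _ i) (bounded _ _ (gridU g) Uc).
  by rewrite ler_norml; lra.
(* There are [(k + 3) ^ d] grid points for [(k + 2) ^ d] cells, so two images share a cell. *)
have /injectivePn[g [g' gg' /cell_close close]] :
    ~~ injectiveb (fun g => cell k.+1 mesh (img g)).
  apply/injectiveP => /leq_card; rewrite !card_ffun !card_ord.
  by rewrite leqNgt ltn_exp2r// ltnSn.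
apply: le_trans (sep g g' gg') _.
apply: (@le_trans _ _ (d%:R * mesh)).
  apply: enorm_le_coord => i; have := close mesh0 (imgbnd g) (imgbnd g') i.
  by rewrite /img !mxE; apply: le_trans; rewrite le_eqVlt; apply/orP; left; apply/eqP; congr `| _ |; ring.
rewrite /mesh mulrA ler_pdivrMr//.
have Xk : X <= 3 * k.+1%:R.
  have : 1 <= k.+1%:R :> R by rewrite ler1n.
  by move: Xhi; rewrite -(natr1 k.+2) -(natr1 k.+1); lra.
have Dz : D = D / r * (X * (2 * d%:R * tau)) by rewrite -rX.
have : D / r * d%:R * (d%:R * tau) * X <= D / r * d%:R * (d%:R * tau) * (3 * k.+1%:R).
  apply: ler_wpM2l Xk; apply: mulr_ge0; first exact: mulr_ge0.
  by rewrite mulr_ge0// ltW.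
by move: Dz; move: (D / r) => z ->; lra.
Qed.

(** The slack moves from the source to the target, so that equal distances can be compared in both
    directions. The cap [rho] leaves room for comparison segments inside a ball. *)
Definition approx_isotonic U (rho eta : R) psi : Prop :=
  forall x y x' y', U x -> U y -> U x' -> U y' ->
    enorm (x - y) <= enorm (x' - y') -> enorm (x' - y') <= rho ->
    enorm (psi x - psi y) <= enorm (psi x' - psi y') + eta.

Lemma enorm_along (c : 'rV[R]_d) i s s' :
  enorm (c + s *: evec i - (c + s' *: evec i)) = `|s - s'|.
Proof. by rewrite opprD addrACA subrr add0r -scalerBl enormZ enorm_evec mulr1. Qed.

(** When [t <= t' <= t + 4 * e], isotony compares the pairs with segments from [c], of length
    [t + 5 * e] above the first and [t' - 5 * e] below the second. Their far ends are at most
    [10 * e] apart, so the Lipschitz bound costs [11 * L * e]. *)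
Lemma coarsely_isotonic_approx U psi (c : 'rV[R]_d) (i0 : 'I_d) (r e L : R) :
  0 < e -> 20 * e <= r -> 0 <= L -> eball c r `<=` U ->
  coarsely_isotonic U e psi ->
  (forall x y, U x -> U y -> enorm (psi x - psi y) <= L * (enorm (x - y) + e)) ->
  approx_isotonic U (r / 2) (11 * L * e) psi.
Proof.
move=> e0 er L0 ball iso lip x y x' y' Ux Uy Ux' Uy' tt' t'r.
have t0 := enorm_ge0 (x - y).
set t := enorm (x - y) in t0 tt'; set t' := enorm (x' - y') in tt' t'r.
have Le : 0 <= L * e by rewrite mulr_ge0// ltW.
have p0 := enorm_ge0 (psi x' - psi y').
case: (ltrP (t + 4 * e) t') => [lt|le].
  by have := iso x y x' y' Ux Uy Ux' Uy' lt; lra.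
(* The lower segment would have negative length; here the Lipschitz bound on [psi x - psi y] alone
   is small enough. *)
case: (ltrP t' (5 * e)) => [t'e|t'e].
  have := lip x y Ux Uy; have : L * (t + e) <= L * (6 * e) by rewrite ler_wpM2l//; lra.
  by rewrite -/t; lra.
pose pt s := c + s *: evec i0.
have ptU s : 0 <= s -> s < r -> U (pt s).
  move=> s0 sr; apply: ball; rewrite /eball /= /pt addrAC subrr add0r.
  by rewrite enormZ enorm_evec mulr1 ger0_norm.
have Up := ptU (t + 5 * e) _ _; have Uq := ptU (t' - 5 * e) _ _; have Uc := ptU 0 _ _.
have h1 : enorm (psi x - psi y) <= enorm (psi (pt (t + 5 * e)) - psi (pt 0)).
  apply: iso => //; [by apply: ptU; lra..|].
  by rewrite enorm_along subr0 ger0_norm -/t; lra.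
have h2 : enorm (psi (pt (t' - 5 * e)) - psi (pt 0)) <= enorm (psi x' - psi y').
  apply: iso => //; [by apply: ptU; lra..|].
  by rewrite enorm_along subr0 ger0_norm -/t'; lra.
have h3 : enorm (psi (pt (t + 5 * e)) - psi (pt (t' - 5 * e))) <= 11 * L * e.
  apply: le_trans (lip _ _ _ _) _; [by apply: ptU; lra..|].
  rewrite enorm_along (_ : 11 * L * e = L * (11 * e)); last by ring.
  have : `|t + 5 * e - (t' - 5 * e)| <= 10 * e by rewrite ler_norml; lra.
  by move=> h; rewrite ler_wpM2l//; lra.
have := enorm_triangle (psi (pt (t' - 5 * e))) (psi (pt (t + 5 * e))) (psi (pt 0)).
by lra.
Qed.

End CoarselyIsotonic.

(** * Proportionality of distances *)

Section ApproximateSimilarity.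
Context {R : realType} {d : nat}.
Implicit Types (U : set 'rV[R]_d) (psi : 'rV[R]_d -> 'rV[R]_d).

(** The deviation [G] from the chord vanishes at both ends and inherits the midpoint estimate. Each
    [s] is the midpoint of an end and of its reflection, so the supremum [M] satisfies
    [M <= (M + kappa) / 2]; [B] makes [M] finite. *)
Lemma midpoint_stability (g : R -> 'rV[R]_d) (kappa B : R) :
  (forall s, -1 <= s <= 1 -> enorm (g s) <= B) ->
  (forall a b, -1 <= a <= 1 -> -1 <= b <= 1 ->
     enorm (g a + g b - 2 *: g ((a + b) / 2)) <= kappa) ->
  forall s, -1 <= s <= 1 ->
    enorm (g s - (((1 - s) / 2) *: g (-1) + ((1 + s) / 2) *: g 1)) <= kappa.
Proof.
move=> gB mid.
pose G s := g s - (((1 - s) / 2) *: g (-1) + ((1 + s) / 2) *: g 1).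
have Gmid a b : -1 <= a <= 1 -> -1 <= b <= 1 ->
    enorm (G a + G b - 2 *: G ((a + b) / 2)) <= kappa.
  move=> a1 b1; apply: le_trans (mid a b a1 b1).
  rewrite le_eqVlt; apply/orP; left; apply/eqP; congr enorm.
  by rewrite /G; apply/rowP => j; rewrite !mxE; field.
have G1 : G 1 = 0 by rewrite /G; apply/rowP => j; rewrite !mxE; field.
have GN1 : G (-1) = 0 by rewrite /G; apply/rowP => j; rewrite !mxE; field.
pose M := sup [set enorm (G s) | s in [set s : R | -1 <= s <= 1]].
have B0 : 0 <= B by apply: le_trans (enorm_ge0 (g 0)) (gB 0 _); lra.
have GM s : -1 <= s <= 1 -> enorm (G s) <= M.
  move=> s1; apply: ub_le_sup; last by exists s.
  exists (3 * B) => _ [{s s1}s /= s1 <-].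
  apply: le_trans (enormB _ _) _.
  have := enormD (((1 - s) / 2) *: g (-1)) (((1 + s) / 2) *: g 1).
  rewrite !enormZ !ger0_norm; [|lra|lra].
  have h1 : (1 - s) / 2 * enorm (g (-1)) <= 1 * B.
    by apply: ler_pM; rewrite ?enorm_ge0//; [lra|lra|apply: gB; lra].
  have h2 : (1 + s) / 2 * enorm (g 1) <= 1 * B.
    by apply: ler_pM; rewrite ?enorm_ge0//; [lra|lra|apply: gB; lra].
  by have := gB s s1; lra.
have half s s' : -1 <= s' <= 1 -> -1 <= 2 * s - s' <= 1 -> G s' = 0 ->
    enorm (G s) <= (M + kappa) / 2.
  move=> s1 s1' Gs'.
  have := Gmid (2 * s - s') s' s1' s1; have := GM _ s1'.
  rewrite Gs' addr0 (_ : (2 * s - s' + s') / 2 = s); last by field.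
  have := enormB (G (2 * s - s')) (G (2 * s - s') - 2 *: G s).
  by rewrite subKr enormZ ger0_norm//; lra.
have Mhalf : M <= (M + kappa) / 2.
  apply: ge_sup; first by exists (enorm (G 0)), 0 => //=; lra.
  move=> _ [s /= s1 <-].
  by case: (lerP 0 s) => s0; [apply: (half s 1)|apply: (half s (-1))] => //; lra.
by move=> s /GM; lra.
Qed.

Lemma enorm_evecB (i j : 'I_d) (s s' : R) : i != j ->
  enorm (s *: evec i - s' *: evec j) = Num.sqrt (s ^+ 2 + s' ^+ 2).
Proof.
move=> ij; rewrite enormE !(dotBl, dotBr, dotZl, dotZr) !dot_evec !eqxx.
by rewrite (eq_sym j) (negbTE ij) /=; congr Num.sqrt; ring.
Qed.

Lemma eball_along (c : 'rV[R]_d) i s r : `|s| < r -> eball c r (c + s *: evec i).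
Proof. by move=> sr; rewrite /eball /= addrAC subrr add0r enormZ enorm_evec mulr1. Qed.

(** One line through [c] suffices: there the midpoint equation makes the distance to [psi c] nearly
    linear, and approximate isotony carries this over to every pair at the same distance. *)
Lemma approx_isotonic_proportional :
  exists2 K : R, 1 <= K &
  forall U psi (c : 'rV[R]_d) (i0 : 'I_d) (rho eta D : R),
  0 < rho -> 0 <= eta -> eball c (4 * rho) `<=` U ->
  approx_isotonic U (2 * rho) eta psi ->
  (forall x y, U x -> U y -> enorm (psi x - psi y) <= D) ->
  exists2 lam : R, 0 <= lam &
    forall x y, U x -> U y -> enorm (x - y) <= rho ->
      `|enorm (psi x - psi y) - lam * enorm (x - y)| <= K * eta.
Proof.
have [K K1 cross] := @cross_polytope_center R d.
exists (2 * K + 1) => [|U psi c i0 rho eta D rho0 eta0 ball iso bounded]; first by lra.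
pose pt s := c + s *: evec i0.
have ptU (s : R) : `|s| < 4 * rho -> U (pt s) by move=> s4; exact/ball/eball_along.
have Uc : U c by rewrite -[c]addr0 -(scale0r (evec i0)); apply: ptU; rewrite normr0; lra.
have mid (m t : R) : `|m| <= rho -> `|t| <= rho ->
    enorm (psi (pt (m + t)) + psi (pt (m - t)) - 2 *: psi (pt m)) <= K * eta.
  move=> mrho trho.
  (* The vertices [v b i] form a cross-polytope centred at [pt m]. Its distances [|t|],
     [sqrt 2 * |t|] and [2 * |t|] are all at most [2 * rho]. *)
  pose sg (b : bool) := if b then t else - t.
  have sgt b : `|sg b| = `|t| by case: b; rewrite /sg ?normrN.
  pose v b i := pt m + sg b *: evec i.
  have Uv b i : U (v b i).
    apply: ball; rewrite /eball /= /v /pt -(addrA c) addrAC subrr add0r.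
    apply: le_lt_trans (enormD _ _) _; rewrite !enormZ !enorm_evec !mulr1 sgt.
    by lra.
  have Um : U (pt m) by apply: ptU; lra.
  have vm b i : enorm (v b i - pt m) = `|t|.
    by rewrite /v addrAC subrr add0r enormZ enorm_evec mulr1 sgt.
  have vv b b' i j : i != j -> enorm (v b i - v b' j) = Num.sqrt (t ^+ 2 + t ^+ 2).
    move=> ij; rewrite /v opprD addrACA subrr add0r enorm_evecB//.
    by rewrite -(real_normK (num_real (sg b))) -(real_normK (num_real (sg b')))
      !sgt real_normK ?num_real.
  have sqrtle : Num.sqrt (t ^+ 2 + t ^+ 2) <= 2 * rho.
    apply: (@le_trans _ _ (Num.sqrt ((2 * `|t|) ^+ 2))).
      rewrite ler_wsqrtr// exprMn real_normK ?num_real//.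
      by have := sqr_ge0 t; lra.
    by rewrite sqrtr_sqr ger0_norm//; lra.
  pose p b i := psi (v b i) - psi (pt m).
  have /(_ i0) : forall j, enorm (p true j + p false j) <= K * eta.
    apply: cross => // [b i b' j|b b' e f i j ij|b i j].
    - by apply: iso; rewrite // !vm//; lra.
    - rewrite /p !opprB !addrA !subrK.
      by apply: iso; rewrite // !vv.
    - rewrite /p opprB addrA subrK.
      have e : enorm (v true j - v false j) = 2 * `|t|.
        rewrite /v opprD addrACA subrr add0r -scalerBl enormZ enorm_evec mulr1.
        have -> : sg true - sg false = 2 * t by rewrite /sg; ring.
        by rewrite normrM ger0_norm.
      by apply: iso; rewrite // ?vm e//; have := normr_ge0 t; lra.
  have vE b : v b i0 = pt (m + sg b) by rewrite /v /pt -addrA -scalerDl.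
  apply: le_trans; rewrite le_eqVlt; apply/orP; left; apply/eqP; congr enorm.
  by rewrite /p !vE; apply/rowP => j; rewrite !mxE; ring.
pose g s := psi (pt (s * rho)) - psi c.
have srho (s : R) : -1 <= s <= 1 -> `|s * rho| <= rho.
  by move=> s1; rewrite normrM (gtr0_norm rho0) ler_piMl ?(ltW rho0)// ler_norml; lra.
have Ups (s : R) : -1 <= s <= 1 -> U (pt (s * rho)).
  by move=> /srho s1; apply: ptU; lra.
have gD (s : R) : -1 <= s <= 1 -> enorm (g s) <= D.
  by move=> /Ups s1; apply: bounded.
have gmid (a b : R) : -1 <= a <= 1 -> -1 <= b <= 1 ->
    enorm (g a + g b - 2 *: g ((a + b) / 2)) <= K * eta.
  move=> a1 b1.
  have := mid ((a + b) / 2 * rho) ((a - b) / 2 * rho) _ _.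
  move=> /(_ _ _)/wrap[||]; [by apply: srho; lra..|].
  rewrite -mulrDl -mulrBl [_ + (a - b) / 2](_ : _ = a); last by field.
  rewrite [_ - (a - b) / 2](_ : _ = b); last by field.
  apply: le_trans; rewrite le_eqVlt; apply/orP; left; apply/eqP; congr enorm.
  by apply/rowP => j; rewrite !mxE; ring.
have line := midpoint_stability gD gmid.
pose ell := enorm (g 1 - g (-1)) / 2.
(* The chord need not pass through [g 0 = 0], so the chord estimate is used at both [s] and [0],
   whence the factor 2. *)
have radial (s : R) : 0 <= s <= 1 -> `|enorm (psi (pt (s * rho)) - psi c) - s * ell| <= K * eta * 2.
  move=> s1.
  have h0 : g 0 = 0.
    by rewrite /g mul0r /pt scale0r addr0 subrr.
  have /line : -1 <= s <= 1 by lra.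
  have /line : -1 <= (0 : R) <= 1 by lra.
  rewrite h0; set u := (X in enorm X <= _ -> _); set w := (X in _ -> enorm X <= _ -> _) => hu hw.
  have -> : s * ell = enorm ((s / 2) *: (g 1 - g (-1))).
    by rewrite enormZ ger0_norm /ell; lra.
  apply: le_trans (enorm_dist _ _) _.
  rewrite (_ : _ - _ = w - u); first by apply: le_trans (enormB _ _) _; lra.
  by rewrite /w /u /g; apply/rowP => j; rewrite !mxE; field.
exists (ell / rho) => [|x y Ux Uy xy].
  by rewrite divr_ge0 ?(ltW rho0)// divr_ge0// enorm_ge0.
have t0 := enorm_ge0 (x - y).
pose s := enorm (x - y) / rho.
have s1 : 0 <= s <= 1 by rewrite /s divr_ge0 ?(ltW rho0)//= ler_pdivrMr// mul1r.
have e : s * rho = enorm (x - y) by rewrite divfK// gt_eqF.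
have -> : ell / rho * enorm (x - y) = s * ell.
  by rewrite -e /s; field; rewrite gt_eqF.
have ptc : enorm (pt (s * rho) - c) = enorm (x - y).
  by rewrite /pt addrAC subrr add0r enormZ enorm_evec mulr1 e ger0_norm.
have Up : U (pt (s * rho)) by apply: Ups; lra.
have h1 := iso x y _ c Ux Uy Up Uc _ _; have h2 := iso _ c x y Up Uc Ux Uy _ _.
rewrite ptc in h1 h2.
have := radial s s1; have := h1 (lexx _) _; have := h2 (lexx _) _.
move=> /(_ _)/wrap[|+ /(_ _)/wrap[|]]; [lra..|].
by rewrite !ler_norml; lra.
Qed.

End ApproximateSimilarity.

(** * Trilateration *)

Section Trilateration.
Context {R : realType} {d : nat}.
Implicit Types (psi S : 'rV[R]_d -> 'rV[R]_d).

Definition similarity_matrix (lam : R) (P : 'M[R]_d) S : Prop :=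
  P *m P^T = 1%:M /\ forall x y, S x - S y = lam *: ((x - y) *m P).

Lemma similarity_matrixP (lam : R) (P : 'M[R]_d) S :
  0 <= lam -> similarity_matrix lam P S -> similarity S.
Proof.
move=> lam0 [PP SP]; exists lam, P, (S 0); split=> // x.
by rewrite -{2}(subr0 x) -SP subrK.
Qed.

Lemma similarity_matrix_dist (lam : R) (P : 'M[R]_d) S x y :
  0 <= lam -> similarity_matrix lam P S ->
  enorm (S x - S y) = lam * enorm (x - y).
Proof.
by move=> lam0 [PP SP]; rewrite SP enormZ ger0_norm// enorm_orthogonal.
Qed.

(** By polarization the distances fix the Gram matrix of the image frame up to [O(eta * ell)].
    Divided by [ell], the frame is nearly orthonormal, and a nearby orthonormal frame supplies
    [P]. *)
Lemma frame_similarity :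
  exists2 K : R, 1 <= K &
  forall psi (y : 'rV[R]_d) (s lam eta : R), 0 <= s -> 0 <= lam -> 0 <= eta ->
  (forall i, `|enorm (psi (y + s *: evec i) - psi y) - lam * s| <= eta) ->
  (forall i j, i != j ->
     `|enorm (psi (y + s *: evec i) - psi (y + s *: evec j))
       - lam * (Num.sqrt 2 * s)| <= eta) ->
  exists P S, [/\ similarity_matrix lam P S, S y = psi y &
    forall i, enorm (psi (y + s *: evec i) - S (y + s *: evec i)) <= K * eta].
Proof.
have [K K1 no] := @near_orthonormal R d.
exists (7 * K + 3) => [|psi y s lam eta s0 lam0 eta0 radial lateral]; first by lra.
pose ell := lam * s; have ell0 : 0 <= ell by rewrite mulr_ge0.
pose p i := psi (y + s *: evec i) - psi y.
have Ke : 0 <= K * eta by rewrite mulr_ge0//; lra.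
have simP (P : 'M[R]_d) : P *m P^T = 1%:M ->
    similarity_matrix lam P (fun x => lam *: ((x - y) *m P) + psi y).
  move=> PP; split=> // u v.
  by rewrite opprD addrACA subrr addr0 -scalerBr -mulmxBl opprB addrA subrK.
have base (P : 'M[R]_d) : lam *: ((y - y) *m P) + psi y = psi y.
  by rewrite subrr mul0mx scaler0 add0r.
have err (P : 'M[R]_d) i :
    psi (y + s *: evec i) - (lam *: ((y + s *: evec i - y) *m P) + psi y) =
    p i - ell *: row i P.
  rewrite (addrAC y) subrr add0r -scalemxAl scalerA -rowE opprD addrCA addrC.
  by rewrite addrAC addrC.
(* Division by a tiny [ell] is avoided: here image frame and target both have size [O(eta)], and the
   identity serves as [P]. *)
case: (lerP ell eta) => [le|lt].
  have PP : 1%:M *m (1%:M : 'M[R]_d)^T = 1%:M by rewrite trmx1 mulmx1.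
  exists 1%:M, (fun x => lam *: ((x - y) *m 1%:M) + psi y).
  split; [exact: simP|exact: base|move=> i; rewrite err].
  apply: le_trans (enormB _ _) _; rewrite enormZ ger0_norm// rowE mulmx1.
  rewrite [enorm (delta_mx _ _)]enorm_evec.
  by have := radial i; rewrite -/(p i) -/ell ler_norml; lra.
have ellpos : 0 < ell by lra.
have rad2 i : `|enorm (p i) ^+ 2 - ell ^+ 2| <= eta * (2 * (2 * ell)).
  have := radial i; rewrite -/(p i) -/ell => h.
  apply: sqr_dist_le => //; first exact: enorm_ge0.
    by move: h; rewrite ler_norml; lra.
  by lra.
have rt2 : Num.sqrt 2 ^+ 2 = 2 :> R by rewrite sqr_sqrtr.
have rt2_0 : 0 <= Num.sqrt 2 :> R by exact: sqrtr_ge0.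
have rt2_2 : Num.sqrt 2 <= 2 :> R.
  by rewrite -(ler_pXn2r (n := 2)) ?nnegrE// rt2 expr2; lra.
have lat2 i j : i != j -> `|enorm (p i - p j) ^+ 2 - 2 * ell ^+ 2| <= eta * (2 * (3 * ell)).
  move=> /lateral; rewrite (mulrCA lam) -/ell.
  have -> : psi (y + s *: evec i) - psi (y + s *: evec j) = p i - p j.
    by rewrite /p opprB addrA subrK.
  have rl : Num.sqrt 2 * ell <= 2 * ell by rewrite ler_wpM2r.
  move=> h; rewrite -[X in X * ell ^+ 2]rt2 -exprMn.
  apply: sqr_dist_le => //; first exact: enorm_ge0.
  - by rewrite mulr_ge0.
  - by move: h; rewrite ler_norml; lra.
  - by lra.
(* Polarization halves the sum of the errors 4, 4 and 6 from [rad2], [rad2] and [lat2]. *)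
have gram i j : `|dot (p i) (p j) - (i == j)%:R * ell ^+ 2| <= 7 * eta * ell.
  have := rad2 i; have := rad2 j; have el0 : 0 <= eta * ell by rewrite mulr_ge0.
  case: (eqVneq i j) => [->|ij] /=.
    by rewrite mul1r sqr_enorm => *; lra.
  have := lat2 i j ij; rewrite mul0r subr0.
  have -> : dot (p i) (p j) =
      (enorm (p i) ^+ 2 + enorm (p j) ^+ 2 - enorm (p i - p j) ^+ 2) / 2.
    rewrite !sqr_enorm; move: (p i) (p j) => u v.
    by rewrite !(dotBl, dotBr) (dotC v u); field.
  by rewrite !ler_norml; lra.
have [|i j|P PP close] := no (fun i => ell^-1 *: p i) (7 * eta / ell).
- by rewrite divr_ge0//; lra.
- rewrite dotZl dotZr mulrA -expr2.
  have -> : ell^-1 ^+ 2 * dot (p i) (p j) - (i == j)%:R =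
      ell^-1 ^+ 2 * (dot (p i) (p j) - (i == j)%:R * ell ^+ 2).
    by field; rewrite gt_eqF.
  rewrite normrM ger0_norm ?exprn_ge0 ?invr_ge0//.
  apply: le_trans (ler_wpM2l _ (gram i j)) _; first by rewrite exprn_ge0// invr_ge0.
  by rewrite le_eqVlt; apply/orP; left; apply/eqP; field; rewrite gt_eqF.
exists P, (fun x => lam *: ((x - y) *m P) + psi y).
split; [exact: simP|exact: base|move=> i; rewrite err].
have -> : p i - ell *: row i P = ell *: (ell^-1 *: p i - row i P).
  by rewrite scalerBr scalerA mulfV ?scale1r// gt_eqF.
rewrite enormZ ger0_norm//.
apply: le_trans (ler_wpM2l ell0 (close i)) _.
rewrite (_ : ell * _ = 7 * (K * eta)); first by lra.
by field; rewrite gt_eqF.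
Qed.

(** With [w = psi x - S x], comparing squared distances to [S z] bounds
    [dot w w + 2 * dot w (S x - S z)]. Subtracting this for two frame points cancels [dot w w] and
    leaves a coordinate of [w] along a row of [P]; the factor [lam] cancels too. *)
Lemma trilateration psi S (lam : R) (P : 'M[R]_d) (x y : 'rV[R]_d) (s rho kappa : R) :
  0 < s -> 0 <= lam -> 0 <= kappa -> similarity_matrix lam P S ->
  let near z := [/\ enorm (x - z) <= rho, enorm (psi z - S z) <= kappa &
    `|enorm (psi x - psi z) - lam * enorm (x - z)| <= kappa] in
  near y -> (forall i, near (y + s *: evec i)) ->
  enorm (psi x - S x) <= (12 * (d%:R * (rho / s)) + 4) * kappa.
Proof.
move=> s0 lam0 kappa0 simS near neary neari.
have rho0 : 0 <= rho by case: neary => h _ _; apply: le_trans h; exact: enorm_ge0.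
have dist := similarity_matrix_dist _ _ lam0 simS.
have lr0 : 0 <= lam * rho by rewrite mulr_ge0.
have dr0 : 0 <= d%:R * (rho / s) * kappa.
  by rewrite mulr_ge0// mulr_ge0 ?ler0n// divr_ge0// ltW.
(* At this scale the triangle inequality through [psi y] and [S y] gives [4 * kappa]. Otherwise
   [kappa < lam * rho], so every distance in [expand] is at most [3 * (lam * rho)]. *)
case: (lerP (lam * rho) kappa) => [small|big].
  have [h1 h2 h3] := neary.
  have h4 := ler_wpM2l lam0 h1.
  have := enorm_triangle (psi y) (psi x) (S x); have := enorm_triangle (S y) (psi y) (S x).
  rewrite (dist y x) (enormC y x).
  by move: h3; rewrite ler_norml; lra.
pose w := psi x - S x.
have expand z : near z ->
    `|dot w w + 2 * dot w (S x - S z)| <= 12 * kappa * (lam * rho).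
  case=> h1 h2 h3; have h4 := ler_wpM2l lam0 h1; have h5 := dist x z.
  have -> : dot w w + 2 * dot w (S x - S z) =
      enorm (psi x - S z) ^+ 2 - enorm (S x - S z) ^+ 2.
    have -> : psi x - S z = w + (S x - S z) by rewrite /w addrA subrK.
    rewrite !sqr_enorm; move: w (S x - S z) => u v.
    by rewrite !(dotDl, dotDr) (dotC v u); ring.
  have h6 := enorm_dist (psi x - S z) (psi x - psi z).
  have h7 : psi x - S z - (psi x - psi z) = psi z - S z.
    by rewrite opprB addrC addrA subrK.
  rewrite h7 in h6.
  have h8 := enorm_ge0 (S x - S z).
  apply: le_trans (_ : 2 * kappa * (2 * (3 * (lam * rho))) <= _); last by lra.
  apply: sqr_dist_le; rewrite ?enorm_ge0//.
  - by move: h3 h6; rewrite !ler_norml; lra.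
  - by lra.
  - by move: h3 h6; rewrite !ler_norml; lra.
have lampos : 0 < lam.
  by rewrite lt_def lam0 andbT; apply: contraTneq big => ->; rewrite mul0r -leNgt.
have proj i : `|dot w (row i P)| <= 12 * (rho / s) * kappa.
  have e : S x - S y - (S x - S (y + s *: evec i)) = (lam * s) *: row i P.
    rewrite opprB addrC addrA subrK; case: simS => _ ->.
    by rewrite addrAC subrr add0r -scalemxAl scalerA -rowE.
  have := expand _ neary; have := expand _ (neari i).
  have : lam * s * dot w (row i P) =
      dot w (S x - S y) - dot w (S x - S (y + s *: evec i)).
    by rewrite -dotBr e dotZr.
  move=> h h1 h2.
  have : `|lam * s * dot w (row i P)| <= 12 * kappa * (lam * rho).
    by rewrite h; move: h1 h2; rewrite !ler_norml; lra.
  rewrite normrM gtr0_norm ?mulr_gt0// -ler_pdivlMl ?mulr_gt0//.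
  move=> {}h; apply: le_trans h _; rewrite le_eqVlt; apply/orP; left; apply/eqP.
  by field; rewrite !gt_eqF.
have [PP _] := simS.
by apply: le_trans (enorm_le_orthonormal PP proj) _; lra.
Qed.

End Trilateration.

(** * Chains of frames *)

Section Chains.
Context {R : realType} {d : nat}.
Implicit Types (U : set 'rV[R]_d) (psi S : 'rV[R]_d -> 'rV[R]_d).

Lemma open_eballP U x : open U -> U x -> exists2 r : R, 0 < r & eball x r `<=` U.
Proof.
move=> Uo Ux; have /nbhs_ballP[r /= r0 ballU] : nbhs x U by exact: open_nbhs_nbhs.
exists r => // y xy; apply: ballU; split=> // i j; rewrite /ball /= ord1 distrC.
by apply: le_lt_trans xy; have := coord_le_enorm (y - x) j; rewrite !mxE.
Qed.

Lemma open_eball x (r : R) : open (eball x r : set 'rV[R]_d).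
Proof.
rewrite openE => y xy; apply/nbhs_ballP.
have d1 : 0 < d.+1%:R :> R by rewrite ltr0n.
exists ((r - enorm (y - x)) / d.+1%:R) => /=; first by rewrite divr_gt0// subr_gt0.
move=> z [_ yz]; rewrite /eball /=; apply: le_lt_trans (enorm_triangle y _ _) _.
rewrite -ltrBrDr.
apply: le_lt_trans (_ : _ <= d%:R * ((r - enorm (y - x)) / d.+1%:R)) _.
  apply: enorm_le_coord => i; have /ltW := yz ord0 i.
  by rewrite /ball /= distrC !mxE.
rewrite mulrCA gtr_pMr ?subr_gt0// ltr_pdivrMr// mul1r ltr_nat.
exact: ltnSn.
Qed.

(** Two intersecting balls have centres less than [2 * sigma] apart. Hence the balls around the
    component of [t] and those around the other net points form disjoint open sets covering [U]. *)
Lemma net_connected (T : finType) (P : T -> 'rV[R]_d) U (sigma : R) :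
  connected U -> 0 < sigma -> (forall t, U (P t)) ->
  (forall x, U x -> exists t, enorm (x - P t) < sigma) ->
  forall t t', connect (fun a b => enorm (P a - P b) < 2 * sigma) t t'.
Proof.
move=> Uc sigma0 UP cover t t'; set e := (X in connect X).
pose balls (A : pred T) : set 'rV[R]_d := \bigcup_(a in [set a | A a]) eball (P a) sigma.
have balls_open A : open (balls A).
  by apply: bigcup_open => a _; exact: open_eball.
pose C := balls (connect e t); pose C' := balls (predC (connect e t)).
have disj x : C x -> C' x -> False.
  move=> [a /= ta xa] [b /= /negP tb xb]; apply: tb.
  apply: connect_trans ta (connect1 _); rewrite /e.
  apply: le_lt_trans (enorm_triangle x _ _) _; rewrite (enormC _ x).
  by move: xa xb; rewrite /eball /=; lra.
have either x : U x -> C x \/ C' x.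
  move=> /cover[a xa]; case: (boolP (connect e t a)) => ta; [left|right];
  by exists a.
have : U `&` C = U.
  apply: Uc.
  - exists (P t); split=> //; exists t; first exact: connect0.
    by rewrite /eball /= subrr enorm0.
  - by exists C => //; exact: balls_open.
  - exists (~` C'); first by apply: open_closedC; exact: balls_open.
    apply/seteqP; split=> x [Ux].
      by move=> Cx; split=> // C'x; exact: disj Cx C'x.
    by move=> C'x; split=> //; case: (either x Ux).
move=> UC; apply/negPn/negP => tt'.
have : C (P t') by have : U (P t') by []; rewrite -{1}UC => -[].
move=> /disj; apply; exists t' => //.
by rewrite /eball /= subrr enorm0.
Qed.

Lemma coarsely_isotonic_near_similarity (N : nat) (theta : R) :
  0 < theta -> theta <= 1 / 16 ->
  exists2 K : R, 0 <= K &
  forall (T : finType) (P : T -> 'rV[R]_d) U psi (c : 'rV[R]_d) (i0 : 'I_d)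
    (r e D : R),
  (#|T| <= N)%N -> connected U -> 0 < r -> 0 < e -> 20 * e <= r ->
  eball c r `<=` U -> coarsely_isotonic U e psi ->
  (forall x y, U x -> U y -> enorm (psi x - psi y) <= D) ->
  (forall t, U (P t)) -> (forall t i, U (P t + (theta * r) *: evec i)) ->
  (forall x, U x -> exists t, enorm (x - P t) < r / 16) ->
  exists2 S, similarity S &
    forall x, U x -> enorm (psi x - S x) <= K * (D / r) * e.
Proof.
move=> theta0 theta1.
have [K2 K21 prop] := @approx_isotonic_proportional R d.
have [K3 K31 frame] := @frame_similarity R d.
(* [q] is the error amplification of one trilateration with [rho = r / 4] and frame side
   [theta * r]. *)
have [q qE q1] : exists2 q : R, q = 12 * (d%:R * (1 / 4 / theta)) + 4 & 1 <= q.
  eexists; first by [].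
  have : 0 <= d%:R * (1 / 4 / theta) :> R by rewrite mulr_ge0 ?ler0n// divr_ge0// ltW.
  by lra.
(* The exponent counts one step from [c] to the net, at most [N] along a simple path, and one to
   [x]; [660 = 11 * 60] combines the approximation and Lipschitz constants. *)
exists (q ^+ N.+2 * (K3 * (K2 * (660 * d%:R ^+ 2)))).
  apply: mulr_ge0; first by apply: exprn_ge0; lra.
  apply: mulr_ge0; first by lra.
  apply: mulr_ge0; first by lra.
  by apply: mulr_ge0; [exact: ler0n|rewrite exprn_ge0// ler0n].
move=> T P U psi c i0 r e D TN Uc r0 e0 er ball iso bounded UP UPs cover.
have D0 : 0 <= D.
  have Ucc : U c by apply: ball; rewrite /eball /= subrr enorm0.
  by apply: le_trans (enorm_ge0 _) (bounded c c Ucc Ucc).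
have d0 : (0 < d)%N by case: d i0 {P U psi c ball iso bounded UP UPs cover prop frame q qE q1 Uc} => [[]|].
have L0 : 0 <= 60 * d%:R ^+ 2 * (D / r).
  apply: mulr_ge0; last by rewrite divr_ge0// ltW.
  by apply: mulr_ge0; [exact: ler0n|rewrite exprn_ge0// ler0n].
have lip := coarsely_isotonic_lipschitz d0 r0 e0 ball iso bounded.
have approx := coarsely_isotonic_approx i0 e0 er L0 ball iso lip.
set eta1 := 11 * _ * e in approx.
have eta10 : 0 <= eta1 by rewrite /eta1; have := mulr_ge0 L0 (ltW e0); lra.
pose rho := r / 4; pose s := theta * r.
have s0 : 0 < s by rewrite mulr_gt0.
have sr : s <= rho / 4.
  by have := ler_wpM2r (ltW r0) theta1; rewrite -/s /rho; lra.
have rho0 : 0 < rho by rewrite divr_gt0.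
have ball4 : eball c (4 * rho) `<=` U by rewrite /rho mulrC divfK.
have approx2 : approx_isotonic U (2 * rho) eta1 psi.
  by rewrite (_ : 2 * rho = r / 2) // /rho; field.
have [lam lam0 dist] := prop U psi c i0 rho eta1 D rho0 eta10 ball4 approx2 bounded.
set eta := K2 * eta1 in dist.
have eta0 : 0 <= eta by rewrite mulr_ge0//; lra.
have Ucc : U c by apply: ball; rewrite /eball /= subrr enorm0.
have Ucs i : U (c + s *: evec i).
  by apply: ball; apply: eball_along; rewrite gtr0_norm//; move: sr; rewrite /rho; lra.
have [i|i j ij|Q [S [simS Sc Sframe]]] := frame psi c s lam eta (ltW s0) lam0 eta0.
- have e1 : enorm (c + s *: evec i - c) = s.
    by rewrite addrAC subrr add0r enormZ enorm_evec mulr1 gtr0_norm.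
  by rewrite -[X in lam * X]e1; apply: dist => //; rewrite e1; lra.
- have e1 : enorm (c + s *: evec i - (c + s *: evec j)) = Num.sqrt 2 * s.
    rewrite opprD addrACA subrr add0r enorm_evecB//.
    have -> : s ^+ 2 + s ^+ 2 = 2 * s ^+ 2 by ring.
    by rewrite sqrtrM// sqrtr_sqr gtr0_norm.
  rewrite -e1; apply: dist => //; rewrite e1.
  have : Num.sqrt 2 <= 2 :> R.
    by rewrite -(ler_pXn2r (n := 2)) ?nnegrE// sqr_sqrtr// expr2; lra.
  by move=> /(ler_wpM2r (ltW s0)); lra.
(* The invariant carried along a chain: a whole frame at [y] lies in [U], and [psi] is within
   [kappa] of [S] on it. *)
pose good (kappa : R) y := [/\ U y, forall i, U (y + s *: evec i),
  enorm (psi y - S y) <= kappa &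
  forall i, enorm (psi (y + s *: evec i) - S (y + s *: evec i)) <= kappa].
(* Since [s <= rho / 4], a point within [3 / 4 * rho] of [y] is within [rho] of the whole frame. *)
have step kappa x y : eta <= kappa -> good kappa y -> U x ->
    enorm (x - y) <= 3 / 4 * rho -> enorm (psi x - S x) <= q * kappa.
  move=> etak [Uy Uys Sy Sys] Ux xy.
  have -> : q = 12 * (d%:R * (rho / s)) + 4.
    by rewrite qE /rho /s; congr (12 * (_ * _) + 4); field; rewrite !gt_eqF.
  apply: (trilateration s0 lam0 _ simS); first by lra.
    split; [by lra|exact: Sy|].
    by apply: le_trans etak; apply: dist => //; lra.
  move=> i; have xys : enorm (x - (y + s *: evec i)) <= rho.
    apply: le_trans (enorm_triangle y _ _) _.
    by rewrite opprD addrA subrr add0r enormN enormZ enorm_evec mulr1 gtr0_norm//; lra.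
  by split; [|exact: Sys|apply: le_trans etak; apply: dist].
(* Edges of the net graph have length below [2 * (r / 16) = rho / 2]; adding [s] keeps the new frame
   within [3 / 4 * rho] of [y]. *)
have good_step kappa t y : eta <= kappa -> good kappa y ->
    enorm (P t - y) <= rho / 2 -> good (q * kappa) (P t).
  move=> etak goody ty; split; [exact: UP|exact: UPs| |].
    by apply: step goody _ _ => //; lra.
  move=> i; apply: step goody _ _ => //.
  apply: le_trans (_ : _ <= enorm (s *: evec i : 'rV[R]_d) + enorm (P t - y)) _.
    by apply: le_trans (enormD _ _); rewrite addrA (addrC (s *: _)).
  by rewrite enormZ enorm_evec mulr1 gtr0_norm//; lra.
have kappa_incr kappa : eta <= kappa -> eta <= q * kappa.
  move=> h; apply: (le_trans h); rewrite ler_peMl//; exact: le_trans eta0 h.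
have good_path kappa t p : eta <= kappa -> good kappa (P t) ->
    path (fun a b => enorm (P a - P b) < 2 * (r / 16)) t p ->
    good (q ^+ size p * kappa) (P (last t p)).
  elim: p t kappa => [|t' p IH] t kappa etak goodt /=; first by rewrite mul1r.
  move=> /andP[tt' pth]; rewrite exprSr -mulrA; apply: IH pth; first exact: kappa_incr.
  apply: good_step goodt _ => //; rewrite enormC; move: tt'; rewrite /rho; lra.
exists S; first exact: similarity_matrixP simS.
pose kappa0 := K3 * eta.
have etak0 : eta <= kappa0 by rewrite ler_peMl.
have goodc : good kappa0 c.
  split=> //; rewrite Sc subrr enorm0; lra.
have [t0 ct0] := cover c Ucc.
have goodt0 : good (q * kappa0) (P t0).
  by apply: good_step goodc _ => //; rewrite enormC /rho; lra.
move=> x Ux; have [t xt] := cover x Ux.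
have r16 : 0 < r / 16 by rewrite divr_gt0.
have /connectP[p pth tE] := net_connected Uc r16 UP cover t0 t.
case/shortenP: pth tE => p' pth uniqp _ tE.
have sizep : (size p' <= N)%N.
  apply: leq_trans TN; apply: leq_trans (max_card (mem (t0 :: p'))).
  by rewrite (card_uniqP uniqp) leqnSn.
have := good_path _ _ _ (kappa_incr _ etak0) goodt0 pth; rewrite -tE => goodt.
have qk : eta <= q ^+ size p' * (q * kappa0).
  apply: le_trans (kappa_incr _ etak0) _; rewrite ler_peMl ?exprn_ege1//.
  by have := kappa_incr _ etak0; lra.
apply: le_trans (step _ _ _ qk goodt Ux _) _; first by rewrite /rho; lra.
rewrite mulrA -exprS mulrA -exprSr.
apply: le_trans (_ : q ^+ N.+2 * kappa0 <= _).
  by rewrite ler_wpM2r ?ler_weXn2l//; lra.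
by rewrite le_eqVlt; apply/orP; left; apply/eqP; rewrite /kappa0 /eta /eta1; ring.
Qed.

End Chains.

(** * Nets and sample points *)

Section Rates.
Context {R : realType} {d : nat}.
Implicit Types (U Q : set 'rV[R]_d) (c : 'rV[R]_d).

(** One point of [U] is chosen in each mesh cell meeting [U], with [u0] as the default for the other
    cells. The shift by [B] puts [U], seen from [u0], into [[0, 2 * B]^d]. *)
Lemma finite_net U (u0 : 'rV[R]_d) (k : nat) (B mesh : R) :
  U u0 -> 0 < mesh -> 2 * B <= k%:R * mesh ->
  (forall x y, U x -> U y -> enorm (x - y) <= B) ->
  exists P : {ffun 'I_d -> 'I_k.+1} -> 'rV[R]_d,
    (forall f, U (P f)) /\
    forall x, U x -> exists f, enorm (x - P f) <= d%:R * mesh.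
Proof.
move=> Uu0 mesh0 Bk UB.
pose z (x : 'rV[R]_d) : 'rV[R]_d := x - u0 + const_mx B.
have zbnd x i : U x -> 0 <= z x ord0 i <= k%:R * mesh.
  move=> Ux; have := le_trans (coord_le_enorm _ i) (UB x u0 Ux Uu0).
  by rewrite /z [X in 0 <= X <= _]mxE [const_mx _ _ _]mxE ler_norml; lra.
have /choice[P PE] (f : {ffun 'I_d -> 'I_k.+1}) : exists p, U p /\
    forall x, U x -> cell k mesh (z x) = f -> enorm (x - p) <= d%:R * mesh.
  have [[p Up pf]|no] := pselect (exists2 p, U p & cell k mesh (z p) = f); last first.
    by exists u0; split=> // x Ux xf; case: no; exists x.
  exists p; split=> // x Ux xf; apply: enorm_le_coord => i.
  have := cell_close mesh0 (fun i => zbnd x i Ux) (fun i => zbnd p i Up) (etrans xf (esym pf)) i.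
  by rewrite (_ : z x - z p = x - p)// /z opprD addrACA subrr addr0 opprB addrA subrK.
exists P; split=> [f|x Ux]; first by have [] := PE f.
by exists (cell k mesh (z x)); have [_] := PE (cell k mesh (z x)); apply.
Qed.

Lemma diam_ge Q : bounded_set Q -> forall x y, Q x -> Q y -> enorm (x - y) <= diam Q.
Proof.
move=> [M [_ /(_ (M + 1))]]; rewrite ltrDl ltr01 => /(_ isT) QM x y Qx Qy.
have QM' u : Q u -> enorm u <= d%:R * (M + 1).
  move=> /QM uM; apply: enorm_le_coord => i; apply: le_trans uM.
  by rewrite [X in _ <= X]mx_normrE; exact: (le_bigmax 0 (fun ij => `|u ij.1 ij.2|) (ord0, i)).
apply: ub_le_sup; last by exists (x, y).
exists (d%:R * (M + 1) + d%:R * (M + 1)) => _ [[u v] /= [Qu Qv] <-].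
by apply: le_trans (enormB _ _) (lerD _ _); exact: QM'.
Qed.

(** The infimum over a finite sample is attained, and boundedness of [U] makes the supremum a true
    upper bound. *)
Lemma deltaH_near U (x : nat -> 'rV[R]_d) (n : nat) (y : 'rV[R]_d) :
  bounded_set U -> (1 <= n)%N -> (forall k, (1 <= k)%N -> U (x k)) -> U y ->
  exists2 k, (1 <= k <= n)%N & enorm (y - x k) <= deltaH (Omega x n) U.
Proof.
case: n => // n bU _ xU Uy.
pose i0 : 'I_n.+1 := ord0.
have inf_ge0 v : 0 <= inf [set enorm (v - u) | u in Omega x n.+1].
  apply: lb_le_inf; first by exists (enorm (v - x 1)), (x 1%N) => //; exists 1%N.
  by move=> _ [u _ <-]; exact: enorm_ge0.
case: (@arg_minP _ _ _ i0 predT (fun i : 'I_n.+1 => enorm (y - x i.+1)) isT) => i _ imin.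
exists i.+1; first by rewrite /= ltn_ord.
apply: (@le_trans _ _ (inf [set enorm (y - u) | u in Omega x n.+1])).
  apply: lb_le_inf; first by exists (enorm (y - x 1)), (x 1%N) => //; exists 1%N.
  move=> _ [u [[//|k] /= kn <-] <-].
  exact: (imin (Ordinal kn) isT).
apply: ub_le_sup; last by exists y.
exists (diam U) => _ [v Uv <-].
apply: (@le_trans _ _ (enorm (v - x 1))); last by apply: diam_ge => //; exact: xU.
apply: ge_inf; first by exists 0 => _ [u _ <-]; exact: enorm_ge0.
by exists (x 1%N) => //; exists 1%N.
Qed.

(** Otherwise every point of [U] would be one of [n] samples, whereas a segment in a ball of [U]
    already provides [n + 1] distinct points. *)
Lemma deltaH_gt0 U (x : nat -> 'rV[R]_d) (n : nat) (i0 : 'I_d) :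
  open U -> U !=set0 -> bounded_set U -> (1 <= n)%N ->
  (forall k, (1 <= k)%N -> U (x k)) -> 0 < deltaH (Omega x n) U.
Proof.
move=> oU [c Uc] bU n1 xU; rewrite ltNge; apply/negP => e0.
have [r r0 ball] := open_eballP oU Uc.
pose y (j : 'I_n.+1) := c + (r / j.+2%:R) *: evec i0.
have Uy j : U (y j).
  apply: ball; apply: eball_along; rewrite gtr0_norm ?divr_gt0 ?ltr0n//.
  by rewrite gtr_pMr// invf_lt1 ?ltr0n// ltr1n.
have near j : exists2 k, (1 <= k <= n)%N & y j = x k.
  have [k kn yk] := deltaH_near bU n1 xU (Uy j); exists k => //.
  apply/subr0_eq/enorm_eq0/le_anti; rewrite enorm_ge0 andbT.
  exact: le_trans yk e0.
have /choice[f fE] j : exists i : 'I_n, y j = x i.+1.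
  have [[//|k] /= kn ->] := near j.
  by exists (Ordinal kn).
have /leq_card : injective f; last by rewrite !card_ord ltnn.
move=> j j' /(congr1 (fun i : 'I_n => x i.+1)); rewrite -!fE /y => /addrI/eqP.
rewrite -subr_eq0 -scalerBl => /eqP/(congr1 (@enorm R d)).
rewrite enormZ enorm_evec mulr1 enorm0 => /normr0_eq0/subr0_eq/(mulfI (lt0r_neq0 r0)).
by move=> /invr_inj/eqP; rewrite eqr_nat => /eqP[] /val_inj.
Qed.

Lemma similarity_cst (b : 'rV[R]_d) : similarity (fun _ : 'rV[R]_d => b).
Proof.
exists 0, 1%:M, b; split; rewrite ?trmx1 ?mulmx1// => x.
by rewrite scale0r add0r.
Qed.

Lemma bigmax_nat_le (F : nat -> R) (n : nat) (a : R) : 0 <= a ->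
  (forall k, (1 <= k <= n)%N -> F k <= a) ->
  \big[Num.max/0]_(1 <= k < n.+1) F k <= a.
Proof.
move=> a0 Fa; rewrite big_nat_cond.
by elim/big_ind : _ => // [u v ua va|k /andP[kn _]]; rewrite ?ge_max ?ua// Fa.
Qed.

(** [K] is fixed before the domain, so domains with nets of bounded size and frames of comparable
    side share the same constant. *)
Lemma similarity_rate_of_net (N : nat) (theta : R) :
  0 < theta -> theta <= 1 / 16 ->
  exists K : R,
  forall (T : finType) (P : T -> 'rV[R]_d) U c (i0 : 'I_d) (r : R),
  (#|T| <= N)%N -> open U -> bounded_set U -> connected U -> 0 < r ->
  eball c r `<=` U ->
  (forall t, U (P t)) -> (forall t i, U (P t + (theta * r) *: evec i)) ->
  (forall x, U x -> exists t, enorm (x - P t) < r / 16) ->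
  similarity_rate U (K / r).
Proof.
move=> theta0 theta1.
have [K K0 near_sim] := @coarsely_isotonic_near_similarity R d N theta theta0 theta1.
exists (K + 20) => T P U c i0 r TN oU bU Uc r0 ball UP UPs cover.
move=> x Q phi xU _ bQ phiP.
suff main n : (1 <= n)%N -> exists2 S, similarity S & forall k, (1 <= k <= n)%N ->
    enorm (phi n (x k) - S (x k)) <= (K + 20) / r * diam Q * deltaH (Omega x n) U.
  have /choice[S SP] n : exists S, (1 <= n)%N -> similarity S /\
      \big[Num.max/0]_(1 <= k < n.+1) enorm (phi n (x k) - S (x k))
        <= (K + 20) / r * diam Q * deltaH (Omega x n) U.
    case: n => [|n]; first by exists id.
    have [S simS SP] := main n.+1 isT; exists S => _; split=> //.
    apply: bigmax_nat_le => //; apply: le_trans (SP 1%N isT); exact: enorm_ge0.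
  by exists S.
move=> n1; have [phiQ iso] := phiP n n1.
have Ucc : U c by apply: ball; rewrite /eball /= subrr enorm0.
have e0 : 0 < deltaH (Omega x n) U.
  by apply: deltaH_gt0 => //; exists c.
have near := deltaH_near bU n1 xU.
set e := deltaH _ _ in e0 near *.
have OmegaP k : (1 <= k <= n)%N -> Omega x n (x k) by move=> kn; exists k.
have QD := diam_ge bQ.
have D0 : 0 <= diam Q.
  have O1 : Omega x n (x 1%N) by apply: OmegaP.
  by apply: le_trans (enorm_ge0 _) (QD _ _ (phiQ _ O1) (phiQ _ O1)).
have Dr0 : 0 <= diam Q / r by rewrite divr_ge0// ltW.
have target : (K + 20) / r * diam Q * e = K * (diam Q / r) * e + 20 * (diam Q / r * e).
  by ring.
rewrite target.
(* If [20 * e > r], then [diam Q] is at most [20 * (diam Q / r * e)]; this accounts for the summand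
   20 in the constant. *)
case: (lerP (20 * e) r) => [small|big]; last first.
  exists (fun=> phi n (x 1%N)); first exact: similarity_cst.
  move=> k kn; apply: (@le_trans _ _ (diam Q)).
    by apply: QD; apply: phiQ; apply: OmegaP.
  have : diam Q / r * r <= diam Q / r * (20 * e) by rewrite ler_wpM2l// ltW.
  rewrite divfK ?gt_eqF//.
  have : 0 <= K * (diam Q / r) * e by rewrite mulr_ge0 ?(ltW e0)// mulr_ge0.
  by lra.
(* The projection to the sample fixes the sample points, so the estimate for [phi n (pr y)] is one
   for [phi n] there. *)
have /choice[pr prP] y : exists z, U y ->
    [/\ Omega x n z, enorm (y - z) <= e & Omega x n y -> z = y].
  have [Oy|nOy] := pselect (Omega x n y).
    by exists y => _; split=> //; rewrite subrr enorm0 ltW.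
  have [Uy|nUy] := pselect (U y); last by exists y.
  by have [k kn yk] := near y Uy; exists (x k) => _; split=> //; exact: OmegaP.
have coarse : coarsely_isotonic U e (fun y => phi n (pr y)).
  move=> u v u' v' Uu Uv Uu' Uv' lt.
  have [Ou hu _] := prP u Uu; have [Ov hv _] := prP v Uv.
  have [Ou' hu' _] := prP u' Uu'; have [Ov' hv' _] := prP v' Uv'.
  apply: iso => //.
  have := enorm_triangle u (pr u) (pr v); have := enorm_triangle v u (pr v).
  have := enorm_triangle (pr u') u' v'; have := enorm_triangle (pr v') (pr u') v'.
  rewrite (enormC (pr u) u) (enormC (pr v') v').
  by lra.
have bnd u v : U u -> U v -> enorm (phi n (pr u) - phi n (pr v)) <= diam Q.
  move=> Uu Uv; have [Ou _ _] := prP u Uu; have [Ov _ _] := prP v Uv.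
  by apply: QD; apply: phiQ.
have [S simS SP] := near_sim T P U _ c i0 r e (diam Q) TN Uc r0 e0 small ball
  coarse bnd UP UPs cover.
exists S => // k kn; have Uxk : U (x k) by apply: xU; case/andP: kn.
have := SP _ Uxk; have [_ _ ->] := prP _ Uxk; last exact: OmegaP.
by have := mulr_ge0 Dr0 (ltW e0); lra.
Qed.

End Rates.

(** * Constants for a domain *)

Lemma similarity_rate_dim0 (R : realType) (U : set 'rV[R]_0) : similarity_rate U 0.
Proof.
move=> x Q phi _ _ _ _; exists (fun _ _ => 0) => n _.
split; first exact: similarity_cst.
by apply: bigmax_nat_le => [|k _]; rewrite !mul0r// [X in enorm X]thinmx0 enorm0.
Qed.

Section Domains.
Context {R : realType} {d : nat}.

(** The net is chosen first: each of its finitely many points has a ball inside [U], and the least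
    radius fixes the side of the frames, hence [theta]. *)
Lemma domain_rate (U : set 'rV[R]_d) (i0 : 'I_d) :
  U !=set0 -> bounded_set U -> connected U -> open U ->
  exists C : R, similarity_rate U C.
Proof.
move=> [c Uc] bU cU oU.
have [r r0 ball] := open_eballP oU Uc.
have d0 : 0 < d%:R :> R by rewrite ltr0n; case: (d) i0 => [[]|].
pose mesh := r / (32 * d%:R).
have mesh0 : 0 < mesh by rewrite divr_gt0// mulr_gt0.
have dmesh : d%:R * mesh = r / 32 by rewrite /mesh; field; rewrite gt_eqF.
have diam0 : 0 <= diam U.
  by apply: le_trans (enorm_ge0 _) (diam_ge bU Uc Uc).
pose k := (Num.truncn (2 * diam U / mesh)).+1.
have kU : 2 * diam U <= k%:R * mesh.
  rewrite -ler_pdivrMr//; have /truncn_itv/andP[_ /ltW//] : 0 <= 2 * diam U / mesh.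
  by rewrite divr_ge0 ?(ltW mesh0)// mulr_ge0.
have [P [UP cover]] := finite_net Uc mesh0 kU (diam_ge bU).
have /choice[s sP] f : exists s : R, 0 < s /\ eball (P f) s `<=` U.
  by have [s s0 sU] := open_eballP oU (UP f); exists s.
(* The default [r / 16] of the minimum ensures [theta <= 1 / 16]. *)
pose s0 := \big[Num.min/r / 16]_f s f.
have s0pos : 0 < s0 by apply: lt_bigmin => [|f _]; [rewrite divr_gt0|case: (sP f)].
have s0s f : s0 <= s f by apply: bigmin_le_cond.
have s0r : s0 <= r / 16 by apply: bigmin_le_id.
pose theta := s0 / 2 / r.
have thetar : theta * r = s0 / 2 by rewrite /theta divfK// gt_eqF.
have [|| K rate] := @similarity_rate_of_net R d #|{ffun 'I_d -> 'I_k.+1}| theta.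
- by rewrite !divr_gt0.
- by rewrite /theta ler_pdivrMr//; lra.
exists (K / r); apply: (rate _ P U c i0 r) => //.
- move=> f i; have [_] := sP f; apply; apply: eball_along.
  by have := s0s f; rewrite thetar gtr0_norm ?divr_gt0//; lra.
- by move=> x /cover[f xf]; exists f; rewrite dmesh in xf; lra.
Qed.

(** With balls of radius [h] available everywhere, [theta] is absolute and the size of the net
    depends only on [d] and [a]. The rate [K / h] equals [K / a / diam U]. *)
Lemma hcore_rate (i0 : 'I_d) (a : R) :
  exists C : R, forall (U : set 'rV[R]_d) (h : R),
    U !=set0 -> bounded_set U -> connected U -> open U ->
    0 < h -> U = hcore U h -> h / diam U = a -> similarity_rate U (C / diam U).
Proof.
have d0 : 0 < d%:R :> R by rewrite ltr0n; case: (d) i0 => [[]|].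
(* For the mesh [h / (32 * d)] used below, [64 * d / a] is the ratio of [2 * diam U] to the mesh. *)
pose k := (Num.truncn (64 * d%:R / a)).+1.
(* Frames of side [h / 64] fit into the balls of radius [h / 32] around the shifted net points. *)
have t0 : 0 < 1 / 64 :> R by lra.
have [|K rate] := @similarity_rate_of_net R d #|{ffun 'I_d -> 'I_k.+1}| (1 / 64) t0.
  by lra.
exists (K / a) => U h [u0 Uu0] bU cU oU h0 UE ha.
have core x : U x -> exists y, [/\ U y, enorm (x - y) < h & eball y h `<=` U].
  by rewrite {1}UE => -[_].
have [c [Uc _ ball]] := core u0 Uu0.
have diam0 : 0 < diam U.
  apply: lt_le_trans (_ : h / 2 <= _); first by rewrite divr_gt0.
  have Uv : U (c + (h / 2) *: evec i0).
    by apply: ball; apply: eball_along; rewrite gtr0_norm ?divr_gt0//; lra.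
  apply: le_trans (diam_ge bU Uv Uc).
  by rewrite addrAC subrr add0r enormZ enorm_evec mulr1 gtr0_norm// divr_gt0.
have a0 : 0 < a by rewrite -ha divr_gt0.
have hE : h = a * diam U by rewrite -ha divfK// gt_eqF.
have -> : K / a / diam U = K / h by rewrite hE; field; rewrite !gt_eqF.
pose mesh := h / (32 * d%:R).
have mesh0 : 0 < mesh by rewrite divr_gt0// mulr_gt0.
have dmesh : d%:R * mesh = h / 32 by rewrite /mesh; field; rewrite gt_eqF.
have kU : 2 * diam U <= k%:R * mesh.
  have e : 2 * diam U = 64 * d%:R / a * mesh.
    by rewrite /mesh hE; field; rewrite !gt_eqF.
  rewrite e ler_wpM2r ?(ltW mesh0)//.
  have /truncn_itv/andP[_ /ltW//] : 0 <= 64 * d%:R / a.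
  by rewrite divr_ge0 ?(ltW a0)// mulr_ge0// ltW.
have [P0 [UP0 cover]] := finite_net Uu0 mesh0 kU (diam_ge bU).
have /choice[y yP] f := core _ (UP0 f).
(* The net is shifted towards centres of balls of radius [h], so that a ball of
   radius [h / 32] around each of its points lies in [U]. *)
pose P f := P0 f + (1 / 32) *: (y f - P0 f).
have PP0 f : enorm (P f - P0 f) < h / 32.
  have [_ + _] := yP f; rewrite enormC.
  by rewrite /P addrAC subrr add0r enormZ ger0_norm//; lra.
have Py f : enorm (P f - y f) < 31 / 32 * h.
  have [_ + _] := yP f.
  have -> : P f - y f = (31 / 32) *: (P0 f - y f).
    by rewrite /P; apply/rowP => j; rewrite !mxE; field.
  by rewrite enormZ ger0_norm//; lra.
apply: (rate _ P U c i0 h) => //.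
- by move=> f; have [_ _] := yP f; apply; rewrite /eball /=; have := Py f; lra.
- move=> f i; have [_ _] := yP f; apply; rewrite /eball /= addrAC.
  apply: le_lt_trans (enormD _ _) _.
  by rewrite enormZ enorm_evec mulr1 gtr0_norm ?mulr_gt0//; have := Py f; lra.
- move=> x /cover[f xf]; exists f; apply: le_lt_trans (enorm_triangle (P0 f) _ _) _.
  by rewrite (enormC (P0 f)); have := PP0 f; rewrite dmesh in xf; lra.
Qed.

End Domains.

Theorem theorem3 (R : realType) :
  (forall (d : nat) (U : set 'rV[R]_d),
     U !=set0 -> bounded_set U -> connected U -> open U ->
     exists C : R, similarity_rate U C) /\
  (exists C' : nat -> R -> R -> R,
     forall (d : nat) (U : set 'rV[R]_d) (h : R),
       U !=set0 -> bounded_set U -> connected U -> open U ->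
       0 < h -> U = hcore U h ->
       similarity_rate U
         (C' d (h / diam U) (inradius_diam U / diam U) / diam U)).
Proof.
split=> [[|d] U|].
- by move=> *; exists 0; exact: similarity_rate_dim0.
- exact: domain_rate ord0.
(* Choosing over all pairs of a dimension and a ratio at once yields a single function, fixed before
   [U] and [h]. *)
have /choice[C CP] (da : nat * R) : exists C : R, forall (U : set 'rV[R]_da.1) (h : R),
    U !=set0 -> bounded_set U -> connected U -> open U ->
    0 < h -> U = hcore U h -> h / diam U = da.2 -> similarity_rate U (C / diam U).
  case: da => -[|d] a /=; last exact: hcore_rate ord0 a.
  by exists 0 => *; rewrite mul0r; exact: similarity_rate_dim0.
by exists (fun d a _ => C (d, a)) => d U h *; exact: (CP (d, h / diam U) U h).
Qed.
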